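(* For every integer $k\geq 1$, as formal power series in $q$ (whose coefficients are Laurent polynomials in $x_1,\ldots,x_k$), \[ \sum_{m_2,\ldots,m_{k+1}=-\infty}^{\infty}\sum_{n=0}^{\infty}D_{k+1}(0,m_2,\ldots,m_{k+1};n)\,x_1^{m_2}\cdots x_k^{m_{k+1}}q^n =\frac{1}{(q;q)_\infty}\sum_{n=1}^{\infty}(-1)^{n-1}q^{n(3n-1)/2+kn}\frac{1-q^n}{\prod_{j=1}^{k}(1-x_jq^n)(1-x_j^{-1}q^n)}. \]
   Context: $(q;q)_\infty=\prod_{j\ge1}(1-q^j)$, and on the right-hand side each factor $1/((1-x_jq^n)(1-x_j^{-1}q^n))$ is expanded as a power series in $q$. A partition $\lambda=(\lambda_1,\ldots,\lambda_s)$ has parts $\lambda_1\ge\cdots\ge\lambda_s\ge1$; $\ell(\lambda)=s$ and $|\lambda|$ is its sum. For a positive integer $K$, a $K$-marked Durfee symbol of $n$ is an array $\tau=\begin{pmatrix}\alpha^K,&\ldots,&\alpha^1\\ \beta^K,&\ldots,&\beta^1\end{pmatrix}_D$ consisting of $K$ pairs $(\alpha^j,\beta^j)$ of partitions and a positive integer $D$ such that: (1) $\alpha^j$ is nonempty for $1\le j<K$, while $\alpha^K$ and all $\beta^j$ may be empty; (2) for $2\le j\le K$, $\beta^{j-1}_1\le\alpha^{j-1}_1\le\min\{\alpha^j_s,\beta^j_s\}$, where $\alpha^j_s,\beta^j_s$ denote smallest parts (minimum over the nonempty ones) and $\beta^{j-1}_1$ the largest part of $\beta^{j-1}$ (vacuous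 if empty); (3) $\alpha^K_1,\beta^K_1\le D$; (4) $\sum_{j=1}^K(|\alpha^j|+|\beta^j|)+D^2=n$. The $j$-th rank is $\rho_j(\tau)=\ell(\alpha^j)-\ell(\beta^j)-1$ for $1\le j<K$ and $\rho_K(\tau)=\ell(\alpha^K)-\ell(\beta^K)$. $D_K(m_1,\ldots,m_K;n)$ denotes the number of $K$-marked Durfee symbols $\tau$ of $n$ with $\rho_j(\tau)=m_j$ for all $1\le j\le K$ (and is $0$ for $n=0$).
   Formalization: In condition (2), when both α^K and β^K are empty, the minimum of the smallest parts (undefined in the text) is taken to be D, so α^{K-1}_1 ≤ D; reading it as vacuous makes the identity false (k=1, n=3, D=1, α^1=(2)). *)

(* Defs.v *)
From HB Require Import structures.
From mathcomp Require Import all_boot all_order all_algebra.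
From mathcomp Require Import finmap zify.
From mathcomp.classical Require Import boolp classical_sets functions cardinality fsbigop.
From mathcomp.multinomials Require Import monalg.

Set Implicit Arguments.
Unset Strict Implicit.
Unset Printing Implicit Defensive.

Import Order.TTheory GRing.Theory Num.Theory.

Local Open Scope fset_scope.
Local Open Scope ring_scope.

(* The ring Z[x_1^{+-1}, ..., x_k^{+-1}], as the group ring of the exponent
   group Z^k.  [malg] only carries a ring structure over a [monomType], which
   excludes groups; hence the alias, which keeps the additive structure of
   [malg] and gets its own (convolution) product. *)

Definition laurent (k : nat) : Type := {malg int[{ffun 'I_k -> int}]}.

HB.instance Definition _ k :=
  GRing.Zmodule.copy (laurent k) {malg int[{ffun 'I_k -> int}]}.

Section LaurentRing.
Variable k : nat.
Implicit Types (f g h : laurent k) (a b : {ffun 'I_k -> int}) (c d : int).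

Definition lmonom c a : laurent k := << c *g a >>.

Definition lone : laurent k := lmonom 1 0.

Definition lmul f g : laurent k :=
  \sum_(a <- msupp f) \sum_(b <- msupp g) lmonom (f@_a * g@_b) (a + b).

Lemma lmonom0 a : lmonom 0 a = 0.
Proof. exact: monalgU0. Qed.

Lemma lmonomD c d a : lmonom (c + d) a = lmonom c a + lmonom d a.
Proof. exact: monalgUD. Qed.

Lemma lmulw (s t : {fset {ffun 'I_k -> int}}) f g :
  msupp f `<=` s -> msupp g `<=` t ->
  lmul f g = \sum_(a <- s) \sum_(b <- t) lmonom (f@_a * g@_b) (a + b).
Proof.
move=> fs gt; rewrite /lmul (big_fset_incl _ fs) /=.
  apply: eq_bigr => a _; apply: big_fset_incl => // b _ /mcoeff_outdom ->.
  by rewrite mulr0 lmonom0.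
move=> a _ /mcoeff_outdom fa; rewrite big1 // => b _.
by rewrite fa mul0r lmonom0.
Qed.

Lemma lmulC : commutative lmul.
Proof.
move=> f g; rewrite /lmul exchange_big; apply: eq_bigr => a _.
by apply: eq_bigr => b _; rewrite mulrC addrC.
Qed.

Lemma lmulDl : left_distributive lmul +%R.
Proof.
move=> f g h.
have gw := fsubset_refl (msupp h).
rewrite (lmulw (fsubsetUl (msupp f) (msupp g)) gw).
rewrite (lmulw (fsubsetUr (msupp f) (msupp g)) gw).
rewrite (lmulw (msuppD_le f g) gw) -big_split /=; apply: eq_bigr => a _.
rewrite -big_split /=; apply: eq_bigr => b _.
by rewrite mcoeffD mulrDl lmonomD.
Qed.

Lemma lmul0 g : lmul 0 g = 0.
Proof. by rewrite /lmul msupp0 big_seq_fset0. Qed.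

Lemma lmul_suml I (r : seq I) (F : I -> laurent k) g :
  lmul (\sum_(i <- r) F i) g = \sum_(i <- r) lmul (F i) g.
Proof. exact: (big_morph (lmul^~ g) (fun _ _ => lmulDl _ _ _) (lmul0 g)). Qed.

Lemma lmul_sumr I (r : seq I) (F : I -> laurent k) g :
  lmul g (\sum_(i <- r) F i) = \sum_(i <- r) lmul g (F i).
Proof. by rewrite lmulC lmul_suml; apply: eq_bigr => i _; rewrite lmulC. Qed.

Lemma lmonomM c d a b :
  lmul (lmonom c a) (lmonom d b) = lmonom (c * d) (a + b).
Proof.
by rewrite (lmulw (@msuppU_le _ _ a c) (@msuppU_le _ _ b d))
           !big_seq_fset1 !mcoeffUU.
Qed.

Lemma laurentE f : f = \sum_(a <- msupp f) lmonom f@_a a.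
Proof. exact: monalgE. Qed.

Lemma lmul1 : left_id lone lmul.
Proof.
move=> f; rewrite [in LHS](laurentE f) lmul_sumr [RHS]laurentE.
by apply: eq_bigr => a _; rewrite lmonomM mul1r add0r.
Qed.

Lemma lmulA : associative lmul.
Proof.
move=> f g h; rewrite (laurentE f) !lmul_suml; apply: eq_bigr => a _.
rewrite (laurentE g) lmul_suml !lmul_sumr lmul_suml; apply: eq_bigr => b _.
rewrite (laurentE h) !lmul_sumr; apply: eq_bigr => c _.
by rewrite !lmonomM mulrA addrA.
Qed.

Lemma lone_neq0 : lone != 0.
Proof.
by apply/eqP => /malgP/(_ 0); rewrite /lone /lmonom mcoeffUU mcoeff0.
Qed.

HB.instance Definition _ := GRing.Zmodule_isComNzRing.Build (laurent k)
  lmulA lmulC lmul1 lmulDl lone_neq0.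

Definition lunit : {pred laurent k} := fun f => `[< exists g, g * f = 1 >].

Definition linv f : laurent k :=
  if pselect (exists g, g * f = 1) is left e then sval (cid e) else f.

Fact lmulVx : {in lunit, left_inverse 1 linv *%R}.
Proof.
by move=> f /asboolP fu; rewrite /linv; case: pselect => // e; case: cid.
Qed.

Fact lunitPl f g : g * f = 1 -> lunit f.
Proof. by move=> gf; apply/asboolP; exists g. Qed.

Fact linv_out : {in [predC lunit], linv =1 id}.
Proof.
by move=> f /asboolPn fu; rewrite /linv; case: pselect.
Qed.

HB.instance Definition _ := GRing.ComNzRing_hasMulInverse.Build (laurent k)
  lmulVx lunitPl linv_out.

Definition lvar (j : 'I_k) : laurent k := lmonom 1 [ffun i => (i == j)%:Z].

Lemma lvar_unit j : lvar j \is a GRing.unit.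
Proof.
apply/unitrPr; exists (lmonom 1 (- [ffun i => (i == j)%:Z])).
by rewrite [LHS]lmonomM mulr1 subrr.
Qed.

End LaurentRing.

(* Formal power series in q, given by their coefficients; q itself is [fvar]. *)
Record fps (R : Type) := Fps { fcoef : nat -> R }.

Notation "{ 'fps' R }" := (fps R) (at level 0, format "{ 'fps'  R }").

HB.instance Definition _ (R : Type) := gen_eqMixin {fps R}.
HB.instance Definition _ (R : Type) := gen_choiceMixin {fps R}.

Lemma fpsP (R : Type) (f g : {fps R}) : fcoef f =1 fcoef g <-> f = g.
Proof. by split=> [|->//]; case: f g => [f] [g] /= /funext ->. Qed.

Section FpsRing.
Variable R : comNzRingType.
Implicit Types f g h : {fps R}.

Definition fzero : {fps R} := Fps (fun=> 0).
Definition fopp f : {fps R} := Fps (fun n => - fcoef f n).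
Definition fadd f g : {fps R} := Fps (fun n => fcoef f n + fcoef g n).

Definition fconst (c : R) : {fps R} := Fps (fun n => c *+ (n == 0)%N).
Definition fmul f g : {fps R} :=
  Fps (fun n => \sum_(i < n.+1) fcoef f i * fcoef g (n - i)).

Fact faddA : associative fadd.
Proof. by move=> f g h; apply/fpsP => n /=; rewrite addrA. Qed.
Fact faddC : commutative fadd.
Proof. by move=> f g; apply/fpsP => n /=; rewrite addrC. Qed.
Fact fadd0 : left_id fzero fadd.
Proof. by move=> f; apply/fpsP => n /=; rewrite add0r. Qed.
Fact faddN : left_inverse fzero fopp fadd.
Proof. by move=> f; apply/fpsP => n /=; rewrite addNr. Qed.

HB.instance Definition _ := GRing.isZmodule.Build {fps R} faddA faddC fadd0 faddN.

Definition ftrunc N f : {poly R} := \poly_(i < N.+1) fcoef f i.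

Lemma fcoef_trunc N f n : (n <= N)%N -> (ftrunc N f)`_n = fcoef f n.
Proof. by move=> nN; rewrite coef_poly ltnS nN. Qed.

Lemma fmul_trunc N f g n : (n <= N)%N ->
  fcoef (fmul f g) n = (ftrunc N f * ftrunc N g)`_n.
Proof.
move=> nN; rewrite coefM; apply: eq_bigr => i _.
rewrite !fcoef_trunc // ?(leq_trans (leq_subr _ _)) //.
by rewrite (leq_trans _ nN) // -ltnS.
Qed.

Fact fmulC : commutative fmul.
Proof.
by move=> f g; apply/fpsP => n; rewrite !(fmul_trunc _ _ (leqnn n)) mulrC.
Qed.

Fact fmulA : associative fmul.
Proof.
move=> f g h; apply/fpsP => n.
have trM f' g' i : (i <= n)%N ->
    (ftrunc n (fmul f' g'))`_i = (ftrunc n f' * ftrunc n g')`_i.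
  by move=> le_in; rewrite fcoef_trunc // (fmul_trunc _ _ le_in).
rewrite !(fmul_trunc _ _ (leqnn n)).
transitivity ((ftrunc n f * (ftrunc n g * ftrunc n h))`_n).
  by rewrite !coefM; apply: eq_bigr => i _; rewrite trM ?leq_subr.
rewrite mulrA !coefM; apply: eq_bigr => i _.
by rewrite trM // -ltnS.
Qed.

Fact fmul1 : left_id (fconst 1) fmul.
Proof.
move=> f; apply/fpsP => n /=; rewrite big_ord_recl /= mul1r subn0.
by rewrite big1 ?addr0 // => i _; rewrite /= mul0r.
Qed.

Fact fmulDl : left_distributive fmul +%R.
Proof.
move=> f g h; apply/fpsP => n /=; rewrite -big_split /=.
by apply: eq_bigr => i _; rewrite mulrDl.
Qed.

Fact fone_neq0 : fconst 1 != 0.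
Proof. by apply/eqP => /(congr1 (fun f => fcoef f 0%N)) /= /eqP; rewrite oner_eq0. Qed.

HB.instance Definition _ := GRing.Zmodule_isComNzRing.Build {fps R}
  fmulA fmulC fmul1 fmulDl fone_neq0.

Definition fvar : {fps R} := Fps (fun n => (n == 1)%N%:R).

Lemma fcoef0 n : fcoef (0 : {fps R}) n = 0. Proof. by []. Qed.
Lemma fcoefD f g n : fcoef (f + g) n = fcoef f n + fcoef g n.
Proof. by []. Qed.
Lemma fcoefN f n : fcoef (- f) n = - fcoef f n. Proof. by []. Qed.
Lemma fcoefC c n : fcoef (fconst c) n = c *+ (n == 0)%N. Proof. by []. Qed.
Lemma fcoef1 n : fcoef (1 : {fps R}) n = (n == 0)%N%:R. Proof. by []. Qed.
Lemma fcoefM f g n :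
  fcoef (f * g) n = \sum_(i < n.+1) fcoef f i * fcoef g (n - i).
Proof. by []. Qed.

Lemma fcoef_varM f n : fcoef (fvar * f) n = if n is m.+1 then fcoef f m else 0.
Proof.
rewrite fcoefM; case: n => [|n]; first by rewrite big_ord1 mul0r.
rewrite big_ord_recl mul0r add0r big_ord_recl mul1r big1 ?addr0 => [|i _].
  by rewrite subSS subn0.
by rewrite mul0r.
Qed.

Lemma fcoef_varX m n : fcoef (fvar ^+ m) n = (n == m)%:R.
Proof.
by elim: m n => [|m IHm] [|n]; rewrite ?expr0 // exprS fcoef_varM ?IHm.
Qed.

(* [flim u] is the coefficientwise limit of a sequence of power series (the
   limit for the q-adic topology): each coefficient is the eventual value of
   the corresponding coefficient of [u N], and 0 if there is none. *)
Definition fcvg (u : nat -> {fps R}) (l : {fps R}) : Prop :=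
  forall n, exists M, forall N, (M <= N)%N -> fcoef (u N) n = fcoef l n.

Definition flim (u : nat -> {fps R}) : {fps R} :=
  Fps (fun n => xget 0 [set c | exists M, forall N, (M <= N)%N ->
                                  fcoef (u N) n = c]%classic).

Lemma fcvg_lim u l : fcvg u l -> flim u = l.
Proof.
move=> ul; apply/fpsP => n /=; case: xgetP => [c _ [M uM]|/(_ (fcoef l n))].
  have [M' uM'] := ul n.
  by rewrite -(uM (maxn M M')) ?uM' ?leq_maxl ?leq_maxr.
by have [M uM] := ul n; case; exists M.
Qed.

Lemma fcvg_series (F : nat -> {fps R}) :
  (forall N n, (n < N)%N -> fcoef (F N) n = 0) ->
  fcvg (fun N => \sum_(1 <= j < N.+1) F j)
       (flim (fun N => \sum_(1 <= j < N.+1) F j)).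
Proof.
move=> F0; set S := fun N : nat => \sum_(1 <= j < N.+1) F j.
suff h : fcvg S (Fps (fun n => fcoef (S n) n)) by rewrite (fcvg_lim h).
move=> n; exists n => N nN /=; rewrite -(subnK nN).
elim: (N - n)%N => [|m IHm] //.
by rewrite addSn /S big_nat_recr // fcoefD IHm F0 ?addr0 // ltnS leq_addl.
Qed.

Definition qpoch_infty : {fps R} :=
  flim (fun N => \prod_(1 <= j < N.+1) (1 - fvar ^+ j)).

Lemma qpoch_infty_cvg :
  fcvg (fun N => \prod_(1 <= j < N.+1) (1 - fvar ^+ j)) qpoch_infty.
Proof.
set P := fun N : nat => \prod_(1 <= j < N.+1) (1 - fvar ^+ j).
have PS n N : (n <= N)%N -> fcoef (P N.+1) n = fcoef (P N) n.
  move=> nN; have -> : P N.+1 = P N * (1 - fvar ^+ N.+1) by exact: big_nat_recr.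
  rewrite mulrBr mulr1 fcoefD fcoefN.
  rewrite mulrC fcoefM big1 ?subr0 // => i _.
  rewrite fcoef_varX ltn_eqF ?mul0r //.
  by rewrite (leq_trans (ltn_ord i)).
suff h : fcvg P (Fps (fun n => fcoef (P n) n)) by rewrite /qpoch_infty (fcvg_lim h).
move=> n; exists n => N nN /=; rewrite -(subnK nN).
by elim: (N - n)%N => [|m IHm] //; rewrite addSn PS // leq_addl.
Qed.

End FpsRing.

Arguments fvar {R}.
Arguments qpoch_infty R : clear implicits.

Section FpsUnitRing.
Variable R : comUnitRingType.
Implicit Types f g : {fps R}.

Fixpoint finv_seq (f : {fps R}) (n : nat) : seq R :=
  if n is m.+1 then
    let s := finv_seq f m in
    rcons s ((fcoef f 0%N)^-1 *
             ((m == 0)%N%:R - \sum_(i < m) fcoef f (m - i) * s`_i))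
  else [::].

Definition funit : {pred {fps R}} := fun f => fcoef f 0%N \is a GRing.unit.

Definition finv f : {fps R} :=
  if fcoef f 0%N \is a GRing.unit then Fps (fun n => (finv_seq f n.+1)`_n) else f.

Lemma size_finv_seq f n : size (finv_seq f n) = n.
Proof. by elim: n => //= n IHn; rewrite size_rcons IHn. Qed.

Lemma nth_finv_seq f n i : (i < n)%N ->
  (finv_seq f n)`_i = (finv_seq f i.+1)`_i.
Proof.
elim: n => // n IHn; rewrite ltnS leq_eqVlt => /predU1P[->//|lt_in].
by rewrite [finv_seq f n.+1]/= nth_rcons size_finv_seq lt_in IHn.
Qed.

Fact fmulVx : {in funit, left_inverse 1 finv *%R}.
Proof.
move=> f; rewrite unfold_in => fu; rewrite mulrC; apply/fpsP => n.
rewrite /finv fu fcoefM fcoef1.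
rewrite (reindex_inj rev_ord_inj) /= big_ord_recr /= subnn subn0.
rewrite nth_rcons size_finv_seq ltnn eqxx.
rewrite mulrA divrr // mul1r.
under eq_bigr => i _.
  rewrite subSS subKn; last by rewrite ltnW.
  rewrite -[rcons _ _]/(finv_seq f i.+1) -(nth_finv_seq _ (ltn_ord i)); over.
by rewrite addrC subrK.
Qed.

Fact funitPl f g : g * f = 1 -> funit f.
Proof.
move=> /(congr1 (fun f => fcoef f 0%N)); rewrite /= big_ord1 subn0 => gf.
by apply/unitrPr; exists (fcoef g 0%N); rewrite mulrC.
Qed.

Fact finv_out : {in [predC funit], finv =1 id}.
Proof. by move=> f fu; rewrite /finv; case: ifP => // /(negP fu). Qed.

HB.instance Definition _ := GRing.ComNzRing_hasMulInverse.Build {fps R}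
  fmulVx funitPl finv_out.

Lemma fps_unitE f : (f \is a GRing.unit) = (fcoef f 0%N \is a GRing.unit).
Proof. by []. Qed.

Lemma fvarM_unit f n : (0 < n)%N -> 1 - f * fvar ^+ n \is a GRing.unit.
Proof.
move=> n0; rewrite fps_unitE fcoefD fcoefN fcoef1 fcoefM big_ord1 fcoef_varX.
by rewrite subnn (ltn_eqF n0) mulr0 subr0 unitr1.
Qed.

Lemma qpoch_infty_unit : qpoch_infty R \is a GRing.unit.
Proof.
have [M /(_ _ (leqnn M)) e] := @qpoch_infty_cvg R 0%N.
rewrite fps_unitE -e -fps_unitE big_nat_cond.
elim/big_ind: _ => [|f g fu gu|j /andP[/andP[j0 _] _]]; first exact: unitr1.
- by rewrite unitrM fu.
- by rewrite -[fvar ^+ j]mul1r fvarM_unit.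
Qed.

End FpsUnitRing.

Definition is_partition (s : seq nat) : bool := sorted geq s && (0%N \notin s).

(* Largest part lambda_1 and smallest part lambda_s of a partition; both are 0
   on the empty partition. *)
Definition largest (s : seq nat) : nat := head 0%N s.
Definition smallest (s : seq nat) : nat := last 0%N s.

(* ((alpha, beta), D), where alpha i and beta i stand for alpha^(i+1) and
   beta^(i+1). *)
Definition symbol (K : nat) : Type :=
  ({ffun 'I_K -> seq nat} * {ffun 'I_K -> seq nat} * nat)%type.

HB.instance Definition _ K := Choice.on (symbol K).

Section MarkedDurfee.
Variable K : nat.
Implicit Types (t : symbol K) (i j : 'I_K).

Definition alpha t := t.1.1.
Definition beta t := t.1.2.
Definition side t := t.2.

(* min{alpha^j_s, beta^j_s}, over the nonempty ones of alpha^j and beta^j.  If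
   both are empty (possible only for the last pair) the minimum is D: all the
   entries of a Durfee symbol are bounded by its subscript D.  Otherwise
   starting from D changes nothing, as all parts are at most D. *)
Definition min_smallest (t : symbol K) (j : 'I_K) : nat :=
  (\big[minn/side t]_(s <- [:: alpha t j; beta t j] | s != [::]) smallest s)%N.

Definition is_marked_durfee (t : symbol K) : Prop :=
  [/\ (0 < side t)%N,
      forall j, is_partition (alpha t j) /\ is_partition (beta t j),
      forall j, (j.+1 < K)%N -> alpha t j != [::],
      forall i j, j = i.+1 :> nat ->
        (largest (beta t i) <= largest (alpha t i))%N /\
        (largest (alpha t i) <= min_smallest t j)%N
    & forall j, j.+1 = K ->
        (largest (alpha t j) <= side t)%N /\ (largest (beta t j) <= side t)%N].

Definition durfee_weight (t : symbol K) : nat :=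
  (\sum_(j < K) (sumn (alpha t j) + sumn (beta t j)) + side t ^ 2)%N.

Definition durfee_rank (t : symbol K) (j : 'I_K) : int :=
  (size (alpha t j))%:Z - (size (beta t j))%:Z - (if (j.+1 < K)%N then 1 else 0).

(* D_K(m_1, ..., m_K; n); the set is finite, see [finite_marked_durfee]. *)
Definition durfee_set (m : {ffun 'I_K -> int}) (n : nat) : set (symbol K) :=
  [set t | [/\ is_marked_durfee t, durfee_weight t = n
             & forall j, durfee_rank t j = m j]]%classic.

Definition durfee_count (m : {ffun 'I_K -> int}) (n : nat) : nat :=
  #|` fset_set (durfee_set m n)|.

Lemma is_partition_bounds (s : seq nat) : is_partition s ->
  (size s <= sumn s)%N /\ all (fun p => p < (sumn s).+1)%N s.
Proof.
case/andP=> _; elim: s => //= p s IHs; rewrite inE negb_or eq_sym -lt0n.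
case/andP=> p0 /IHs[les alls]; split; first by rewrite -add1n leq_add.
rewrite ltnS leq_addr /=; apply: sub_all alls => r; rewrite !ltnS => rs.
by rewrite (leq_trans rs) ?leq_addl.
Qed.

Lemma finite_marked_durfee m n : finite_set (durfee_set m n).
Proof.
pose T := ({ffun 'I_K -> n.-bseq 'I_n.+1} *
           {ffun 'I_K -> n.-bseq 'I_n.+1} * 'I_n.+1)%type.
pose up (s : n.-bseq 'I_n.+1) : seq nat := [seq val p | p <- s].
pose g (x : T) : symbol K :=
  ([ffun j => up (x.1.1 j)], [ffun j => up (x.1.2 j)], val x.2).
apply: (@sub_finite_set _ _ (g @` [set: T])%classic); last first.
  exact/finite_image/finite_finset.
move=> t [[_ pt _ _ _] wt _].
have bound j : (sumn (alpha t j) + sumn (beta t j) <= n)%N.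
  rewrite -wt /durfee_weight (bigD1 j) //= -addnA.
  exact: leq_addr.
pose dn (s : seq nat) : n.-bseq 'I_n.+1 :=
  insub_bseq n [seq inord p | p <- s].
have dnK s : is_partition s -> (sumn s <= n)%N -> up (dn s) = s.
  move=> /is_partition_bounds[szs als] sn; rewrite /up /dn /insub_bseq val_insubd.
  rewrite size_map (leq_trans szs sn) -map_comp map_id_in // => p ps /=.
  by rewrite inordK // (leq_trans (allP als _ ps)).
exists ([ffun j => dn (alpha t j)], [ffun j => dn (beta t j)], inord (side t)) => //.
case: t => -[a b] D in pt wt bound *; rewrite /g /=; congr (_, _, _).
- apply/ffunP => j; rewrite !ffunE dnK //; first by have [] := pt j.
  exact: leq_trans (leq_addr _ _) (bound j).
- apply/ffunP => j; rewrite !ffunE dnK //; first by have [] := pt j.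
  exact: leq_trans (leq_addl _ _) (bound j).
rewrite inordK // ltnS -wt /durfee_weight /side /=.
by rewrite (leq_trans _ (leq_addl _ _)) // -mulnn; case: (D) => // d; rewrite leq_pmull.
Qed.

Lemma durfee_count0 m : durfee_count m 0%N = 0%N.
Proof.
rewrite /durfee_count; suff -> : durfee_set m 0%N = set0 by rewrite fset_set0 cardfs0.
apply/seteqP; split=> // t [[D0 _ _ _ _] + _].
by move/eqP; rewrite /durfee_weight addn_eq0 expn_eq0 andbT (gtn_eqF D0) andbF.
Qed.

Lemma durfee_rank_bound m n j : (durfee_set m n !=set0)%classic -> `|m j| <= n%:Z.
Proof.
case=> t [[D0 pt _ _ _] wt /(_ j) <-].
have [[/is_partition_bounds[sa _]] [/is_partition_bounds[sb _]]] :=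
  ((pt j).1, (pt j).2).
have : (sumn (alpha t j) + sumn (beta t j) + side t ^ 2 <= n)%N.
  by rewrite -wt /durfee_weight leq_add2r (bigD1 j) //= leq_addr.
have : (0 < side t ^ 2)%N by rewrite expn_gt0 D0.
rewrite /durfee_rank; case: ifP => _; lia.
Qed.

End MarkedDurfee.

(* The rank vector (0, m_2, ..., m_{k+1}). *)
Definition cons0 (k : nat) (m : {ffun 'I_k -> int}) : {ffun 'I_k.+1 -> int} :=
  [ffun i => oapp m 0 (unlift ord0 i)].

(* In the coefficient of q^n of the generating function only finitely many rank
   vectors occur, so the sum over all of Z^k is a finite sum. *)
Lemma finite_support_durfee k n :
  finite_set [set m : {ffun 'I_k -> int} | durfee_count (cons0 m) n != 0%N].
Proof.
pose g (x : {ffun 'I_k -> 'I_n.*2.+1}) : {ffun 'I_k -> int} :=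
  [ffun j => (x j)%:Z - n%:Z].
apply: (@sub_finite_set _ _ (g @` setT)%classic); last first.
  exact/finite_image/finite_finset.
move=> m /= mn.
have bm j : `|m j| <= n%:Z.
  rewrite -[m j]/(oapp m 0 (Some j)) -(liftK ord0 j).
  rewrite -[oapp _ _ _](ffunE (fun i => oapp m 0 (unlift ord0 i))).
  apply: durfee_rank_bound.
  apply/set0P; apply: contra_neq mn => m0.
  by rewrite /durfee_count m0 fset_set0 cardfs0.
exists [ffun j => inord (absz (m j + n%:Z))] => //.
apply/ffunP => j; rewrite !ffunE; have := bm j => bj.
by rewrite inordK; move: (m j) bj => z; rewrite ler_norml => /andP[]; lia.
Qed.

(* Main.v *)
(** Delete from each [alpha^j] with [j < K] its largest part [M_j]: for fixed
    [M_1 <= ... <= M_(K-1) <= M_K = D] the symbols become independent pairs of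
    partitions with parts in [[M_(j-1), M_j]] (where [M_0 = 1]), enumerated by
    [\prod_(M_(j-1) <= l <= M_j) 1 / ((1 - x q^l) (1 - q^l / x))].  Its partial
    fraction expansion is
    [\sum_n A_n(M_(j-1)) B_n(M_j) / ((1 - x q^n) (1 - q^n / x))] where [A] and
    [B] are the inverse pair of Bailey matrices, so that
    [\sum_M q^M B_n(M) A_p(M) = q^n [n = p]] and summing over
    [M_1, ..., M_(K-1)] leaves a single sum over [n].  Finally
    [\sum_D q^(D^2) B_n(D)] is evaluated by Durfee's rectangle identity.
    Restricting the first rank to [0] replaces the factor
    [1 / ((1 - x q^n) (1 - q^n / x))] by its constant term
    [1 / (1 - q^(2n))] in [x]. *)

Require Import Defs.
From mathcomp Require Import all_boot all_order all_algebra.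
From mathcomp Require Import finmap.
From mathcomp.classical Require Import boolp classical_sets functions cardinality fsbigop.
From mathcomp Require Import zify ring.

Set Implicit Arguments.
Unset Strict Implicit.
Unset Printing Implicit Defensive.

Import Order.TTheory GRing.Theory Num.Theory.

Local Open Scope ring_scope.

(** * Partial fractions and Bailey inversion *)

Section PartialFractions.
Variables (S : comUnitRingType) (q : S) (g : nat -> nat -> S).
Hypothesis g_unit : forall i l, (i < l)%N -> g i l \is a GRing.unit.
Hypothesis gB : forall i M N, (M <= i)%N -> (i <= N)%N ->
  g i N + q ^+ (N - i) * g M i = g M N.

(* [bdown n M * bup n N] is the coefficient of [1 / e n] in the partial fraction
   expansion of [\prod_(M <= l <= N) 1 / e l], where
   [e l - q^(l - n) * e n = g n l] for [n <= l]; the factors with [l < n] are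
   cleared of negative exponents. *)
Definition bup (n N : nat) : S := \prod_(n.+1 <= l < N.+1) (g n l)^-1.
Definition bdown (n M : nat) : S := \prod_(M <= l < n) (- q ^+ (n - l) / g l n).

Lemma gnn n : g n n = 0.
Proof.
have := gB (leqnn n) (leqnn n); rewrite subnn expr0 mul1r => /eqP.
by rewrite -subr_eq0 addrK => /eqP.
Qed.

Lemma bup_nn n : bup n n = 1.
Proof. by rewrite /bup big_geq. Qed.

Lemma bdown_nn n : bdown n n = 1.
Proof. by rewrite /bdown big_geq. Qed.

Lemma bupS n N : (n <= N)%N -> g n N.+1 * bup n N.+1 = bup n N.
Proof.
move=> nN; rewrite /bup big_nat_recr //= mulrC mulrVK ?g_unit //.
Qed.

Lemma bdownS n M : (M < n)%N ->
  g M n * bdown n M = - q ^+ (n - M) * bdown n M.+1.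
Proof.
by move=> Mn; rewrite /bdown big_ltn // mulrA mulrCA mulrV ?g_unit ?mulr1.
Qed.

(* The partial sums telescope: [g n p] times the sum over [M < m] is
   [- q^p g n m (bup n m) (bdown p m)]. *)
Lemma bup_bdown_orthogonal n p : (n < p)%N ->
  \sum_(n <= M < p.+1) q ^+ M * bup n M * bdown p M = 0.
Proof.
move=> np.
have tele j : (n + j <= p)%N ->
    g n p * (\sum_(n <= M < n + j) q ^+ M * bup n M * bdown p M) =
    - q ^+ p * (g n (n + j) * bup n (n + j) * bdown p (n + j)).
  elim: j => [|j IHj] jp.
    by rewrite addn0 big_geq // gnn !mul0r !mulr0.
  rewrite addnS big_nat_recr ?leq_addr //= mulrDr IHj; last by lia.
  set M := (n + j)%N; have Mp : (M < p)%N by rewrite /M; lia.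
  have nM : (n <= M)%N by rewrite leq_addr.
  have -> : g n p = g M p + q ^+ (p - M) * g n M by rewrite gB // ltnW.
  have -> : q ^+ p = q ^+ M * q ^+ (p - M) by rewrite -exprD subnKC // ltnW.
  rewrite bupS //.
  have e := bdownS Mp.
  have -> : - (q ^+ M * q ^+ (p - M)) * (bup n M * bdown p M.+1) =
     q ^+ M * bup n M * (g M p * bdown p M) by rewrite e; ring.
  ring.
apply: (mulrI (g_unit np)); rewrite mulr0 big_nat_recr ?(ltnW np) //=.
have := tele (p - n)%N; rewrite subnKC ?(ltnW np) // => /(_ (leqnn p)) e.
rewrite mulrDr e bdown_nn; ring.
Qed.

Lemma bdown_bup_rec i M N : (M < N)%N -> (M <= i)%N -> (i <= N)%N ->
  g M N * (bdown i M * bup i N) =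
  (if (i < N)%N then bdown i M * bup i N.-1 else 0) -
  q ^+ (N - M) * (if (M < i)%N then bdown i M.+1 * bup i N else 0).
Proof.
move=> MN Mi iN; rewrite -(gB Mi iN) mulrDl; congr (_ + _).
  case: ltnP => [lt_iN | Ni].
    by rewrite mulrCA; case: N lt_iN {MN iN} => // N lt_iN; rewrite bupS.
  by rewrite (_ : i = N) ?gnn ?mul0r //; apply/eqP; rewrite eqn_leq iN.
case: ltnP => [Mi' | iM].
  have -> : (N - M = (N - i) + (i - M))%N by lia.
  by rewrite exprD mulrA -(mulrA (q ^+ _)) bdownS //; ring.
rewrite (_ : i = M) ?gnn ?mul0r ?mulr0 ?mul0r ?oppr0 //.
by apply/eqP; rewrite eqn_leq iM.
Qed.

(* Both sides satisfy the same divided-difference recursion. *)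
Lemma partial_fractions (F : nat -> nat -> S) :
  (forall M N, (0 < M < N)%N ->
     g M N * F M N = F M N.-1 - q ^+ (N - M) * F M.+1 N) ->
  forall M N, (0 < M <= N)%N ->
  F M N = \sum_(M <= i < N.+1) bdown i M * bup i N * F i i.
Proof.
move=> Frec M N /andP[M0 MN].
have [j] : exists j, N = (M + j)%N by exists (N - M)%N; lia.
elim: j M N M0 MN => [|j IHj] M N M0 MN ->.
  by rewrite addn0 big_nat1 bdown_nn bup_nn !mul1r.
have MN' : (M < M + j.+1)%N by lia.
apply: (mulrI (g_unit MN')); rewrite Frec ?M0 // mulr_sumr.
rewrite (IHj M (M + j.+1).-1) ?(IHj M.+1 (M + j.+1)%N) //; try lia.
set w := fun i M N => bdown i M * bup i N.
transitivity (\sum_(M <= i < (M + j.+1).+1)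
   ((if (i < M + j.+1)%N then w i M (M + j.+1).-1 else 0) * F i i -
    q ^+ (M + j.+1 - M) * (if (M < i)%N then w i M.+1 (M + j.+1)%N else 0)
      * F i i)); last first.
  rewrite !big_nat; apply: eq_bigr => i /andP[Mi iN].
  by rewrite mulrA bdown_bup_rec ?mulrBl // Mi -ltnS.
rewrite sumrB; congr (_ - _).
  rewrite prednK ?addn_gt0 ?M0 // [in RHS]big_nat_recr /=; last by lia.
  rewrite ltnn mul0r addr0 !big_nat; apply: eq_bigr => i /andP[_ iN].
  by rewrite iN.
rewrite [in RHS]big_ltn; last by lia.
rewrite ltnn mulr0 mul0r add0r mulr_sumr !big_nat; apply: eq_bigr => i /andP[Mi _].
by rewrite Mi mulrA.
Qed.

End PartialFractions.

Section Gaps.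
Variables (S : comUnitRingType) (q : S).
Hypothesis q_unit : forall n, (0 < n)%N -> 1 - q ^+ n \is a GRing.unit.

Definition sgap (i l : nat) : S := 1 - q ^+ (l - i).
Definition bgap (i l : nat) : S := sgap i l * (1 - q ^+ (l + i)).

Lemma sgap_unit i l : (i < l)%N -> sgap i l \is a GRing.unit.
Proof. by move=> il; rewrite q_unit // subn_gt0. Qed.

Lemma bgap_unit i l : (i < l)%N -> bgap i l \is a GRing.unit.
Proof. by move=> il; rewrite unitrM sgap_unit ?q_unit //; lia. Qed.

Lemma sgapB i M N : (M <= i)%N -> (i <= N)%N ->
  sgap i N + q ^+ (N - i) * sgap M i = sgap M N.
Proof.
move=> Mi iN; rewrite /sgap (_ : N - M = (N - i) + (i - M))%N; last by lia.
rewrite exprD; ring.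
Qed.

Lemma bgapB i M N : (M <= i)%N -> (i <= N)%N ->
  bgap i N + q ^+ (N - i) * bgap M i = bgap M N.
Proof.
move=> Mi iN; have [a ia] : exists a, i = (M + a)%N by exists (i - M)%N; lia.
have [b Nb] : exists b, N = (M + a + b)%N by exists (N - i)%N; lia.
subst i N; rewrite /bgap /sgap.
have -> : (M + a + b - (M + a) = b)%N by lia.
have -> : (M + a - M = a)%N by lia.
have -> : (M + a + b - M = a + b)%N by lia.
rewrite !exprD; ring.
Qed.

Lemma prodV_shrink (e : nat -> S) M N : (M < N)%N ->
  (forall l, (M <= l <= N)%N -> e l \is a GRing.unit) ->
  let F M N := \prod_(M <= l < N.+1) (e l)^-1 in
  F M N.-1 = e N * F M N /\ F M.+1 N = e M * F M N.
Proof.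
move=> MN eu /=; split.
  case: N MN eu => // N MN eu; rewrite [in RHS]big_nat_recr /=; last by lia.
  by rewrite mulrC mulrVK // eu //; lia.
by rewrite [in RHS]big_ltn ?mulrA ?mulrV ?mul1r ?eu //; lia.
Qed.

Lemma partial_fractions_pair (x y : S) M N : x * y = 1 ->
  (forall n, (0 < n)%N -> (1 - x * q ^+ n) * (1 - y * q ^+ n) \is a GRing.unit) ->
  (0 < M <= N)%N ->
  \prod_(M <= l < N.+1) ((1 - x * q ^+ l) * (1 - y * q ^+ l))^-1 =
  \sum_(M <= i < N.+1) bdown q bgap i M * bup bgap i N *
    ((1 - x * q ^+ i) * (1 - y * q ^+ i))^-1.
Proof.
move=> xy eu MN; set e := fun l => (1 - x * q ^+ l) * (1 - y * q ^+ l).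
pose F M N := \prod_(M <= l < N.+1) (e l)^-1.
rewrite -[LHS]/(F M N) (partial_fractions bgap_unit bgapB) //; last first.
  move: M N MN => _ _ _ M N /andP[M0 MN].
  rewrite /F; have [|-> ->] := @prodV_shrink e M N MN.
    by move=> l ?; apply: eu; lia.
  rewrite mulrA -mulrBl; congr (_ * _).
  have [b Nb] : exists b, N = (M + b)%N by exists (N - M)%N; lia.
  subst N; rewrite /bgap /sgap /e addKn !exprD.
  transitivity (1 + q^+ M * q ^+ b * (q ^+ M * q ^+ b) * (x * y)
    - q ^+ b - q ^+ b * q ^+ M * q ^+ M * (x * y)); last by ring.
  by rewrite xy; ring.
by apply: eq_bigr => i _; rewrite /F big_nat1.
Qed.

Lemma sum_coef_single M N : (0 < M <= N)%N ->
  \sum_(M <= i < N.+1) bdown q sgap i M * bup sgap i N = 1.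
Proof.
move=> MN; have := @partial_fractions _ q _ sgap_unit sgapB (fun _ _ => 1) _ M N MN.
move=> ->; first by apply: eq_bigr => i _; rewrite mulr1.
by move=> ? ? _; rewrite /= /sgap !mulr1.
Qed.

Lemma partial_fractions_single x M N :
  (forall n, (0 < n)%N -> 1 - x * q ^+ n \is a GRing.unit) ->
  (0 < M <= N)%N ->
  \prod_(M <= l < N.+1) (1 - x * q ^+ l)^-1 =
  \sum_(M <= i < N.+1) bdown q sgap i M * bup sgap i N / (1 - x * q ^+ i).
Proof.
move=> eu MN; pose e l := 1 - x * q ^+ l.
pose F M N := \prod_(M <= l < N.+1) (e l)^-1.
rewrite -[LHS]/(F M N) (partial_fractions sgap_unit sgapB) //; last first.
  move: M N MN => _ _ _ M N /andP[M0 MN].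
  rewrite /F; have [|-> ->] := @prodV_shrink e M N MN.
    by move=> l ?; apply: eu; lia.
  rewrite mulrA -mulrBl; congr (_ * _).
  have [b Nb] : exists b, N = (M + b)%N by exists (N - M)%N; lia.
  by subst N; rewrite /sgap /e addKn !exprD; ring.
by apply: eq_bigr => i _; rewrite /F big_nat1.
Qed.

Lemma coef_single_pair i M N : (0 < M <= i)%N -> (i <= N)%N ->
  bdown q sgap i M * bup sgap i N * \prod_(M <= l < N.+1) (1 - q ^+ (l + i))^-1 =
  bdown q bgap i M * bup bgap i N / (1 - q ^+ i.*2).
Proof.
move=> /andP[M0 Mi] iN; rewrite (big_cat_nat (n := i)) //=; last by lia.
rewrite (big_ltn (m := i)) //= addnn.
have -> : bdown q bgap i M =
    bdown q sgap i M * \prod_(M <= l < i) (1 - q ^+ (l + i))^-1.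
  rewrite /bdown -big_split !big_nat; apply: eq_bigr => l /andP[Ml li] /=.
  by rewrite /bgap invrM ?sgap_unit ?q_unit ?(addnC i) ?mulrA 1?mulrAC //; lia.
have -> : bup bgap i N =
    bup sgap i N * \prod_(i.+1 <= l < N.+1) (1 - q ^+ (l + i))^-1.
  rewrite /bup -big_split !big_nat; apply: eq_bigr => l /andP[il lN] /=.
  by rewrite /bgap invrM ?sgap_unit ?q_unit 1?mulrC //; lia.
ring.
Qed.

Lemma sum_coef_single2 M N : (0 < M <= N)%N ->
  \sum_(M <= i < N.+1) \sum_(M <= j < N.+1)
    bdown q sgap i M * bup sgap i N * (bdown q sgap j M * bup sgap j N) /
      (1 - q ^+ (i + j)) =
  \sum_(M <= i < N.+1) bdown q bgap i M * bup bgap i N / (1 - q ^+ i.*2).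
Proof.
move=> MN; rewrite !big_nat; apply: eq_bigr => i /andP[Mi iN].
rewrite -coef_single_pair ?Mi //; last by lia.
transitivity (bdown q sgap i M * bup sgap i N *
    \prod_(M <= l < N.+1) (1 - q ^+ i * q ^+ l)^-1).
  rewrite partial_fractions_single // ?mulr_sumr => [|n n0]; last first.
    by rewrite -exprD q_unit ?addn_gt0 ?n0 ?orbT.
  by apply: eq_bigr => j _; rewrite -exprD -!mulrA.
by congr (_ * _); apply: eq_bigr => l _; rewrite -exprD addnC.
Qed.

End Gaps.

(** * q-Pochhammer symbols and the Durfee rectangle identity *)

Section QPochhammer.
Variables (S : comUnitRingType) (q : S).
Hypothesis q_unit : forall n, (0 < n)%N -> 1 - q ^+ n \is a GRing.unit.

Definition qpoch (n : nat) : S := \prod_(1 <= l < n.+1) (1 - q ^+ l).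

Lemma qpoch0 : qpoch 0 = 1.
Proof. by rewrite /qpoch big_geq. Qed.

Lemma qpochS n : qpoch n.+1 = qpoch n * (1 - q ^+ n.+1).
Proof. by rewrite /qpoch big_nat_recr. Qed.

Lemma qpoch_unit n : qpoch n \is a GRing.unit.
Proof.
by elim: n => [|n IHn]; rewrite ?qpoch0 ?unitr1 // qpochS unitrM IHn q_unit.
Qed.

Lemma qpochVS n : (1 - q ^+ n.+1) / qpoch n.+1 = (qpoch n)^-1.
Proof. by rewrite qpochS invrM ?qpoch_unit ?q_unit // mulrA divrr ?q_unit ?mul1r. Qed.

Lemma bup_qpoch n m :
  bup (bgap q) n (n + m) = qpoch n.*2 / (qpoch m * qpoch (m + n.*2)).
Proof.
elim: m => [|m IHm].
  by rewrite addn0 bup_nn qpoch0 add0n mul1r divrr ?qpoch_unit.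
have -> : bup (bgap q) n (n + m.+1) =
    bup (bgap q) n (n + m) / ((1 - q ^+ m.+1) * (1 - q ^+ (m + n.*2).+1)).
  rewrite addnS {1}/bup big_nat_recr ?leq_addr //= /bgap /sgap; congr (_ / (_ * _)).
    by congr (1 - q ^+ _); lia.
  by congr (1 - q ^+ _); lia.
rewrite IHm addSn !qpochS -mulrA -invrM ?unitrM ?qpoch_unit ?q_unit //.
by congr (_ / _); ring.
Qed.

Lemma bdown1_qpoch n : (0 < n)%N ->
  bdown q (bgap q) n 1 * qpoch n.*2 =
  (-1) ^+ n.-1 * q ^+ 'C(n, 2) * (1 - q ^+ n) * (1 - q ^+ n.*2).
Proof.
case: n => // n _; rewrite /= doubleS qpochS.
have down j : (j <= n)%N ->
    bdown q (bgap q) n.+1 (n.+1 - j) * (qpoch j * qpoch n.*2.+1) =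
    (-1) ^+ j * q ^+ 'C(j.+1, 2) * qpoch (n.*2.+1 - j).
  elim: j => [|j IHj] jn.
    by rewrite !subn0 bdown_nn qpoch0 bin_small // !mul1r.
  have e : (n.+1 - j.+1).+1 = (n.+1 - j)%N by lia.
  have lt : (n.+1 - j.+1 < n.+1)%N by lia.
  have := bdownS q (bgap_unit q_unit) lt; rewrite e {1}/bgap /sgap.
  have -> : (n.+1 - (n.+1 - j.+1) = j.+1)%N by lia.
  have -> : (n.+1 + (n.+1 - j.+1) = (n.*2.+1 - j.+1).+1)%N by lia.
  move=> rec; have pos : (0 < (n.*2.+1 - j.+1).+1)%N by [].
  apply: (mulrI (q_unit pos)).
  transitivity ((1 - q ^+ j.+1) * (1 - q ^+ (n.*2.+1 - j.+1).+1) *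
      bdown q (bgap q) n.+1 (n.+1 - j.+1) * (qpoch j * qpoch n.*2.+1)).
    by rewrite qpochS; ring.
  rewrite rec -mulrA IHj ?(ltnW jn) // (binS j.+1) bin1 exprD exprS.
  have -> : (n.*2.+1 - j = (n.*2.+1 - j.+1).+1)%N by lia.
  rewrite qpochS (exprS (-1)); move: (1 - q ^+ (_ - _).+1) => w; ring.
have := down n (leqnn n); rewrite subSnn (_ : n.*2.+1 - n = n.+1)%N; last by lia.
rewrite (qpochS n) => e; apply: (mulrI (qpoch_unit n)).
transitivity (bdown q (bgap q) n.+1 1 * (qpoch n * qpoch n.*2.+1)
  * (1 - q ^+ n.*2.+2)); first by ring.
rewrite e; ring.
Qed.

Definition durfee_sum (N r : nat) : S :=
  \sum_(0 <= m < N.+1) q ^+ (m * (m + r)) / (qpoch (N - m) * qpoch m * qpoch (m + r)).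

Lemma durfee_sumE N r : durfee_sum N r = (qpoch N * qpoch (N + r))^-1.
Proof.
have u n := qpoch_unit n.
elim: N r => [|N IHN] r.
  by rewrite /durfee_sum big_nat1 mul0n expr0 sub0n qpoch0 add0n !mul1r.
apply: (mulrI (q_unit (ltn0Sn N))).
transitivity (durfee_sum N r + q ^+ (N.+1 + r) * durfee_sum N r.+1).
  transitivity (\sum_(0 <= m < N.+2)
      (1 - q ^+ (N.+1 - m)) * (q ^+ (m * (m + r)) /
         (qpoch (N.+1 - m) * qpoch m * qpoch (m + r))) +
    \sum_(0 <= m < N.+2)
      q ^+ (N.+1 - m) * (1 - q ^+ m) * (q ^+ (m * (m + r)) /
         (qpoch (N.+1 - m) * qpoch m * qpoch (m + r)))).
    rewrite mulr_sumr -big_split /= !big_nat; apply: eq_bigr => m /andP[_ mN] /=.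
    rewrite -mulrDl; congr (_ * _).
    rewrite -{1}(@subnK m N.+1) // exprD; ring.
  congr (_ + _).
    rewrite big_nat_recr //= subnn expr0 subrr mul0r addr0.
    rewrite /durfee_sum !big_nat; apply: eq_bigr => m /andP[_ mN].
    rewrite subSn // mulrCA; congr (_ * _).
    rewrite !invrM ?unitrM ?u // [in LHS]mulrCA.
    by rewrite [in LHS](mulrCA (1 - _)) qpochVS.
  rewrite big_nat_recl //= expr0 subrr mulr0 mul0r add0r.
  rewrite /durfee_sum mulr_sumr !big_nat; apply: eq_bigr => m /andP[_ mN].
  rewrite subSS !invrM ?unitrM ?u // addSnnS.
  have e : q ^+ (N - m) * q ^+ (m.+1 * (m + r.+1)) =
           q ^+ (N.+1 + r) * q ^+ (m * (m + r.+1)).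
    by rewrite -!exprD; congr (q ^+ _); nia.
  rewrite -(qpochVS m) [in RHS]mulrA -e.
  move: (q ^+ (N - m)) (q ^+ (_ * _)) (q ^+ m.+1) => *; ring.
rewrite !IHN !invrM ?u // addSn addnS qpochS invrM ?u ?q_unit //.
rewrite [in RHS]mulrCA qpochVS; have := mulVr (q_unit (ltn0Sn (N + r))).
move: (q ^+ (N + r).+1) => w; move: ((1 - w)^-1) => v.
move: ((qpoch (N + r))^-1) ((qpoch N)^-1) => a b vw.
by rewrite -[a * b in LHS]mulr1 -vw; ring.
Qed.

End QPochhammer.

Lemma exchange_triangle (V : nmodType) m N (F : nat -> nat -> V) :
  \sum_(m <= j < N) \sum_(m <= i < j.+1) F i j =
  \sum_(m <= i < N) \sum_(i <= j < N) F i j.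
Proof.
transitivity (\sum_(m <= j < N) \sum_(m <= i < N | (i <= j)%N) F i j).
  rewrite !big_nat; apply: eq_bigr => j /andP[_ jN].
  by rewrite (big_nat_widen _ _ N).
rewrite (exchange_big_dep_nat xpredT) //= !big_nat.
by apply: eq_bigr => i /andP[mi _]; rewrite [RHS](big_nat_widenl _ m).
Qed.

Lemma bup_bdown_comp (S : comUnitRingType) (q : S) (g : nat -> nat -> S) :
  (forall i l, (i < l)%N -> g i l \is a GRing.unit) ->
  (forall i M N, (M <= i)%N -> (i <= N)%N ->
    g i N + q ^+ (N - i) * g M i = g M N) ->
  forall (a b : nat -> S) M D,
  \sum_(M <= m < D.+1) q ^+ m *
     (\sum_(M <= i < m.+1) bdown q g i M * bup g i m * a i) *
     (\sum_(m <= j < D.+1) bdown q g j m * bup g j D * b j) =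
  \sum_(M <= i < D.+1) bdown q g i M * bup g i D * (q ^+ i * a i * b i).
Proof.
move=> g_unit gB a b M D.
pose F i j m := q ^+ m * bup g i m * bdown q g j m *
  (bdown q g i M * a i * (bup g j D * b j)).
transitivity (\sum_(M <= i < D.+1) \sum_(i <= j < D.+1) \sum_(i <= m < j.+1) F i j m).
  transitivity (\sum_(M <= m < D.+1) \sum_(M <= i < m.+1) \sum_(m <= j < D.+1) F i j m).
    apply: eq_bigr => m _; rewrite -mulrA mulrCA mulr_suml; apply: eq_bigr => i _.
    by rewrite !mulr_sumr; apply: eq_bigr => j _; rewrite /F; ring.
  by rewrite exchange_triangle; apply: eq_bigr => i _; rewrite -exchange_triangle.
rewrite !big_nat; apply: eq_bigr => i /andP[Mi iD].
rewrite big_ltn // big_nat1 big_nat big1 ?addr0 => [|j /andP[ij _]].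
  by rewrite /F bup_nn bdown_nn; ring.
by rewrite /F -mulr_suml (bup_bdown_orthogonal g_unit gB) ?mul0r.
Qed.

Section Valuation.
Variable R : comUnitRingType.
Implicit Types f g : {fps R}.
Notation q := (@fvar R).

Definition qdvd N f := forall i, (i < N)%N -> fcoef f i = 0.

Lemma qdvdW M N f : (M <= N)%N -> qdvd N f -> qdvd M f.
Proof. by move=> MN fN i iM; rewrite fN // (leq_trans iM). Qed.

Lemma qdvd0 N : qdvd N 0. Proof. by []. Qed.

Lemma qdvdD N f g : qdvd N f -> qdvd N g -> qdvd N (f + g).
Proof. by move=> fN gN i iN; rewrite fcoefD fN ?gN ?addr0. Qed.

Lemma qdvdN N f : qdvd N f -> qdvd N (- f).
Proof. by move=> fN i iN; rewrite fcoefN fN ?oppr0. Qed.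

Lemma qdvdM M N f g : qdvd M f -> qdvd N g -> qdvd (M + N) (f * g).
Proof.
move=> fM gN i iMN; rewrite fcoefM big1 // => j _.
case: (ltnP j M) => jM; first by rewrite fM ?mul0r.
rewrite gN ?mulr0 //; move: (ltn_ord j) jM iMN; move: (nat_of_ord j) => p; lia.
Qed.

Lemma qdvdMl N f g : qdvd N g -> qdvd N (f * g).
Proof. by move=> gN; apply: (@qdvdM 0). Qed.

Lemma qdvdX n : qdvd n (q ^+ n).
Proof. by move=> i iN; rewrite fcoef_varX ltn_eqF. Qed.

Lemma qdvd_sum N (I : Type) (r : seq I) (P : pred I) (F : I -> {fps R}) :
  (forall i, P i -> qdvd N (F i)) -> qdvd N (\sum_(i <- r | P i) F i).
Proof. by move=> FN; elim/big_ind: _ => // f g; apply: qdvdD. Qed.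

Lemma fvarX_unit n : (0 < n)%N -> 1 - q ^+ n \is a GRing.unit.
Proof. by move=> n0; rewrite -[q ^+ n]mul1r fvarM_unit. Qed.

Lemma qpoch_sub N m : (m <= N)%N -> qdvd (N - m).+1 (qpoch q N - qpoch q (N - m)).
Proof.
elim: N m => [|N IHN] [|m] // mN; rewrite ?subrr ?subn0 ?subrr //; try exact: qdvd0.
rewrite subSS qpochS mulrBr mulr1 addrAC; apply: qdvdD; first exact: IHN.
apply/qdvdN/qdvdMl; apply: qdvdW (@qdvdX _); lia.
Qed.

Lemma qpoch_infty_sub N : qdvd N.+1 (qpoch_infty R - qpoch q N).
Proof.
move=> i iN; have [M /(_ (maxn M N) (leq_maxl _ _))] := @qpoch_infty_cvg R i.
rewrite -/(qpoch q _) => Mi.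
rewrite fcoefD fcoefN -Mi -fcoefN -fcoefD.
have := @qpoch_sub (maxn M N) (maxn M N - N).
by rewrite subKn ?leq_maxr // leq_subr; apply.
Qed.

Lemma durfee_sum_infty N r :
  qdvd N.+1 (qpoch_infty R * (\sum_(0 <= m < N.+1) q ^+ (m * (m + r)) /
                                (qpoch q m * qpoch q (m + r))) - 1).
Proof.
have u n := qpoch_unit fvarX_unit n.
set s := \sum_(0 <= m < N.+1) _.
have sE : qdvd N.+1 (s - (qpoch q (N + r))^-1).
  have -> : (qpoch q (N + r))^-1 = qpoch q N * durfee_sum q N r.
    by rewrite (durfee_sumE fvarX_unit) invrM ?u // mulrCA mulrV ?mulr1 ?u.
  rewrite /s /durfee_sum mulr_sumr -sumrB big_nat; apply: qdvd_sum => m /andP[_ mN].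
  have -> : q ^+ (m * (m + r)) / (qpoch q m * qpoch q (m + r)) -
      qpoch q N * (q ^+ (m * (m + r)) /
        (qpoch q (N - m) * qpoch q m * qpoch q (m + r))) =
      - ((qpoch q m * qpoch q (m + r))^-1 / qpoch q (N - m)) *
      (q ^+ (m * (m + r)) * (qpoch q N - qpoch q (N - m))).
    rewrite -[qpoch q (N - m) * _ * _]mulrA [in X in _ - _ * X = _]invrM ?unitrM ?u //.
    have := mulVr (u (N - m)%N).
    move: (_ ^-1) => a; move: (_^-1) => b ab.
    rewrite -[X in X - _]mulr1 -ab; ring.
  apply: qdvdMl; apply: (@qdvdW _ (m * (m + r) + (N - m).+1)); first by nia.
  apply: qdvdM; [exact: qdvdX | exact: qpoch_sub].
have -> : qpoch_infty R * s - 1 =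
    qpoch_infty R * (s - (qpoch q (N + r))^-1) +
    (qpoch q (N + r))^-1 * (qpoch_infty R - qpoch q (N + r)).
  transitivity (qpoch_infty R * s - (qpoch q (N + r))^-1 * qpoch q (N + r)).
    by rewrite mulVr.
  ring.
apply: qdvdD; apply: qdvdMl => //.
by apply: qdvdW (@qpoch_infty_sub _); lia.
Qed.

Lemma durfee_to_pentagonal (c : nat -> {fps R}) N :
  qdvd N.+1
   (qpoch_infty R * (\sum_(1 <= D < N.+1) q ^+ (D ^ 2) *
      \sum_(1 <= n < D.+1) bdown q (bgap q) n 1 * bup (bgap q) n D * c n) -
    \sum_(1 <= n < N.+1) (-1) ^+ n.-1 * q ^+ (n * (3 * n - 1) %/ 2) *
      (1 - q ^+ n) * (1 - q ^+ n.*2) * c n).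
Proof.
under [X in qpoch_infty R * X]eq_bigr do rewrite mulr_sumr.
rewrite exchange_triangle mulr_sumr -sumrB big_nat.
apply: qdvd_sum => n /andP[n0 nN].
have -> : \sum_(n <= D < N.+1)
      q ^+ (D ^ 2) * (bdown q (bgap q) n 1 * bup (bgap q) n D * c n) =
    bdown q (bgap q) n 1 * qpoch q n.*2 * c n * q ^+ (n ^ 2) *
    \sum_(0 <= m < (N - n).+1) q ^+ (m * (m + n.*2)) /
       (qpoch q m * qpoch q (m + n.*2)).
  rewrite -{1}[n]add0n big_addn subSn // mulr_sumr; apply: eq_bigr => m _.
  rewrite (addnC m) (bup_qpoch fvarX_unit) -mulnn -mulnn.
  have -> : ((n + m) * (n + m) = n * n + m * (m + n.*2))%N by lia.
  by rewrite exprD; ring.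
have := @durfee_sum_infty (N - n) n.*2; set s := \sum_(_ <= _ < _) _ => sN.
have -> : (n * (3 * n - 1) %/ 2 = 'C(n, 2) + n ^ 2)%N.
  have := bin2 n; have := mul_bin_diag n 1; rewrite bin1; nia.
rewrite (bdown1_qpoch fvarX_unit) // exprD.
set p := (-1) ^+ n.-1 * q ^+ 'C(n, 2) * (1 - q ^+ n) * (1 - q ^+ n.*2).
have -> : qpoch_infty R * (p * c n * q ^+ (n ^ 2) * s) -
    (-1) ^+ n.-1 * (q ^+ 'C(n, 2) * q ^+ (n ^ 2)) * (1 - q ^+ n) *
    (1 - q ^+ n.*2) * c n =
  p * c n * (q ^+ (n ^ 2) * (qpoch_infty R * s - 1)).
  rewrite /p; move: (q ^+ (n ^ 2)) (q ^+ 'C(n, 2)) ((-1) ^+ n.-1) => x y z.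
  move: (1 - q ^+ n.*2) (1 - q ^+ n) => v w; ring.
apply: qdvdMl; apply: (@qdvdW _ (n ^ 2 + (N - n).+1)); first by nia.
by apply: qdvdM => //; apply: qdvdX.
Qed.

End Valuation.

(** * Summable families of power series *)

Section Summation.
Variable R : comUnitRingType.
Implicit Types F G : {fps R}.
Local Open Scope classical_set_scope.

(* Unconditional summability for the q-adic topology. *)
Definition has_sum (T : choiceType) (A : set T) (f : T -> {fps R}) F :=
  forall N, exists X : seq T, [/\ uniq X, forall t, t \in X -> A t,
    forall t, A t -> t \notin X -> qdvd N (f t)
    & qdvd N (F - \sum_(t <- X) f t)].

Lemma has_sum_ext (T : choiceType) (A B : set T) f g F G :
  A = B -> (forall t, A t -> f t = g t) -> F = G ->
  has_sum A f F -> has_sum B g G.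
Proof.
move=> <- fg <- fF N; have [X [uX XA tX FX]] := fF N; exists X; split=> //.
  by move=> t At; rewrite -fg //; apply: tX.
by rewrite -(@eq_big_seq _ _ _ _ _ f) // => t /XA; apply: fg.
Qed.

Lemma has_sum_set0 (T : choiceType) f : has_sum (set0 : set T) f 0.
Proof. by move=> N; exists [::]; split=> //; rewrite big_nil subrr; apply: qdvd0. Qed.

Lemma has_sum_set1 (T : choiceType) (x : T) f : has_sum [set x] f (f x).
Proof.
move=> N; exists [:: x]; split=> // [t|t -> |]; first by rewrite inE => /eqP.
  by rewrite inE eqxx.
by rewrite big_seq1 subrr; apply: qdvd0.
Qed.

Lemma has_sumZ (T : choiceType) (A : set T) c f F :
  has_sum A f F -> has_sum A (fun t => c * f t) (c * F).
Proof.
move=> fF N; have [X [uX XA tX FX]] := fF N; exists X; split=> //.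
  by move=> t At tNX; apply: qdvdMl; apply: tX.
by rewrite -mulr_sumr -mulrBr; apply: qdvdMl.
Qed.

Lemma has_sumM (T U : choiceType) (A : set T) (B : set U) f g F G :
  has_sum A f F -> has_sum B g G ->
  has_sum (A `*` B) (fun p => f p.1 * g p.2) (F * G).
Proof.
move=> fF gG N; have [X [uX XA tX FX]] := fF N; have [Y [uY YB tY GY]] := gG N.
exists [seq (s, t) | s <- X, t <- Y]; split.
- by apply: allpairs_uniq => // -[a b] [c d].
- by move=> _ /allpairsP[p [/XA Ap /YB Bp ->]].
- move=> [s t] [/= As Bt] stN; case: (boolP (s \in X)) => [sX | sX].
    apply: qdvdMl; apply: tY => //; apply: contra stN => tYt.
    by apply/allpairsP; exists (s, t).
  by rewrite mulrC; apply: qdvdMl; apply: tX.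
rewrite big_allpairs /=.
under eq_bigr do rewrite -mulr_sumr.
rewrite -mulr_suml.
set SX := \sum_(_ <- X) _; set SY := \sum_(_ <- Y) _.
rewrite (_ : _ - _ = F * (G - SY) + SY * (F - SX)); last by ring.
by apply: qdvdD; apply: qdvdMl.
Qed.

Lemma has_sumU (T : choiceType) (A B : set T) f F G :
  A `&` B `<=` set0 -> has_sum A f F -> has_sum B f G ->
  has_sum (A `|` B) f (F + G).
Proof.
move=> AB fF fG N; have [X [uX XA tX FX]] := fF N; have [Y [uY YB tY GY]] := fG N.
exists (X ++ Y); split.
- rewrite cat_uniq uX uY andbT; apply/hasPn => t /YB Bt; apply/negP => /XA At.
  by have := AB t (conj At Bt).
- by move=> t; rewrite mem_cat => /orP[/XA|/YB]; [left|right].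
- by move=> t + /[!mem_cat]/norP[tNX tNY] => -[At|Bt]; [apply: tX | apply: tY].
rewrite big_cat opprD addrACA; exact: qdvdD.
Qed.

Lemma has_sum_image (T U : choiceType) (A : set T) (B : set U) (h : T -> U) f g F :
  (forall s t, A s -> A t -> h s = h t -> s = t) -> h @` A = B ->
  (forall t, A t -> g t = f (h t)) -> has_sum A g F -> has_sum B f F.
Proof.
move=> hI <- gf gF N; have [X [uX XA tX FX]] := gF N; exists (map h X); split.
- by rewrite map_inj_in_uniq // => s t /XA As /XA At; apply: hI.
- by move=> _ /mapP[t /XA At ->]; exists t.
- move=> _ [t At <-] tN; rewrite -gf //; apply: tX => //.
  by apply: contra tN; apply: map_f.
by rewrite big_map (@eq_big_seq _ _ _ _ _ (f \o h) g) // => t /XA /gf.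
Qed.

Lemma has_sum_widen (T : choiceType) (A B : set T) f F :
  A `<=` B -> (forall t, B t -> ~ A t -> f t = 0) ->
  has_sum A f F -> has_sum B f F.
Proof.
move=> AB f0 fF N; have [X [uX XA tX FX]] := fF N; exists X; split=> //.
  by move=> t /XA /AB.
move=> t Bt tNX; case: (pselect (A t)) => [At | NAt]; first exact: tX.
by rewrite f0 //; apply: qdvd0.
Qed.

Lemma has_sum_label (T : choiceType) (A : set T) (lab : T -> nat) f
    (F : nat -> {fps R}) N :
  (forall l, (l < N)%N -> has_sum [set t | A t /\ lab t = l] f (F l)) ->
  has_sum [set t | A t /\ (lab t < N)%N] f (\sum_(0 <= l < N) F l).
Proof.
elim: N => [|N IHN] fF.
  apply: has_sum_ext (@has_sum_set0 T f) => //; last by rewrite big_geq.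
  by apply/seteqP; split=> // t [_].
apply: has_sum_ext (has_sumU _ (IHN _) (fF N _)) => //.
- apply/seteqP; split=> t /=; first by move=> [[At lt]|[At <-]]; split=> //; lia.
  case=> At; rewrite ltnS leq_eqVlt => /predU1P[|lt]; by [right | left].
- by rewrite big_nat_recr.
- by move=> t [[_ lt] [_ e]]; move: lt; rewrite e ltnn.
by move=> l lN; apply: fF; lia.
Qed.

Lemma has_sum_limit (T : choiceType) (A : set T) (lab : T -> nat) f
    (F : nat -> {fps R}) G :
  (forall l, has_sum [set t | A t /\ lab t = l] f (F l)) ->
  (forall t, A t -> qdvd (lab t) (f t)) ->
  (forall N, qdvd N (G - \sum_(0 <= l < N) F l)) ->
  has_sum A f G.
Proof.
move=> fF ft FG N; have fN l : (l < N)%N -> _ := fun=> fF l.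
have [X [uX XA tX FX]] := has_sum_label fN N; exists X; split=> //.
- by move=> t /XA[].
- move=> t At tNX; case: (ltnP (lab t) N) => lt; first exact: tX.
  exact: qdvdW lt (ft t At).
by rewrite -[G](subrK (\sum_(0 <= l < N) F l)) -addrA; apply: qdvdD.
Qed.

Lemma has_sum_coef (T : choiceType) (A : set T) f F n :
  has_sum A f F -> fcoef F n = \sum_(t \in A) fcoef (f t) n.
Proof.
move=> /(_ n.+1)[X [uX XA tX /(_ n (ltnSn n))/eqP]].
rewrite fcoefD fcoefN subr_eq0 => /eqP ->.
rewrite (@fsbigE _ _ _ _ A X _ uX XA) => [|t At tNX]; last by rewrite (tX t).
rewrite (@big_morph _ _ (fun f => fcoef f n) 0 +%R) // [RHS]big_mkcond.
by apply: eq_big_seq => t /XA At; rewrite mem_set.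
Qed.

Lemma geometric_sub (z : {fps R}) N : 1 - z \is a GRing.unit ->
  (1 - z)^-1 - \sum_(0 <= l < N) z ^+ l = z ^+ N * (1 - z)^-1.
Proof.
move=> zu; apply: (mulrI zu); rewrite mulrBr mulrCA divrr // mulr1.
by rewrite big_mkord -[1 - z]opprB mulNr -subrX1 opprB subKr.
Qed.

End Summation.

(** * Pairs of partitions *)

Definition inparts (M N : nat) (s : seq nat) : bool :=
  is_partition s && all (fun p => M <= p <= N)%N s.

Lemma inparts_nil M N : inparts M N [::].
Proof. by []. Qed.

Lemma inparts_cons M N p s :
  inparts M N (p :: s) = [&& (0 < p)%N, (M <= p <= N)%N & inparts M p s].
Proof.
rewrite /inparts /is_partition /= inE negb_or (path_sortedE (rev_trans leq_trans)).
rewrite eq_sym -lt0n; apply/idP/idP.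
  case/and3P=> /andP[/andP[sp ss] /andP[p0 s0]] pMN sMN; rewrite p0 pMN ss s0 /=.
  by apply/allP => r rs; have := allP sMN r rs; have := allP sp r rs; lia.
case/and3P=> p0 pMN /andP[/andP[ss s0] sMp]; rewrite p0 pMN ss s0 !andbT /=.
apply/andP; split; apply/allP => r rs; have := allP sMp r rs; lia.
Qed.

Lemma inpartsS M N s : inparts M N.+1 s =
  inparts M N s || (if s is p :: s' then
    [&& (M <= N.+1)%N, p == N.+1 & inparts M N.+1 s'] else false).
Proof.
case: s => [|p s]; rewrite ?inparts_nil // !inparts_cons.
case: (ltngtP p N.+1) => [pN|pN|->]; rewrite ?andbF ?orbF.
- by rewrite -(ltnS p) pN.
- by rewrite (leqNgt p N) (ltnW pN) ?andbF.
by rewrite ltnn !andbT !andbF.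
Qed.



Lemma inparts_size_sum M N s : inparts M N s -> (size s <= sumn s)%N.
Proof. by case/andP=> /is_partition_bounds[]. Qed.

Section PartitionSums.
Variable R : comUnitRingType.
Notation q := (@fvar R).
Local Open Scope classical_set_scope.

Lemma fconstM (a b : R) : fconst (a * b) = fconst a * fconst b.
Proof.
apply/fpsP => n; rewrite fcoefM big_ord_recl big1 ?addr0 => [|i _] /=.
  by rewrite subn0 mulr1n mulrnAr.
by rewrite mulr0n mul0r.
Qed.

Lemma fconst1 : fconst (1 : R) = 1. Proof. by []. Qed.

Lemma fconst0 : fconst (0 : R) = 0.
Proof. by apply/fpsP => n; rewrite fcoefC mul0rn. Qed.

Lemma fconstX (a : R) n : fconst (a ^+ n) = fconst a ^+ n.
Proof. by elim: n => [|n IHn]; rewrite ?expr0 ?fconst1 // !exprS fconstM IHn. Qed.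

Lemma has_sum_inparts_size M N l : (0 < M <= N)%N ->
  has_sum [set s | inparts M N s /\ size s = l] (fun s => q ^+ sumn s)
    (\sum_(M <= i < N.+1) bdown q (sgap q) i M * bup (sgap q) i N * q ^+ (i * l)).
Proof.
case/andP=> M0 MN; have [j ->] : exists j, N = (M + j)%N by exists (N - M)%N; lia.
have su := sgap_unit (@fvarX_unit R).
elim: j l {N MN} => [|j IHj] l.
  rewrite addn0; apply: has_sum_ext (has_sum_set1 (nseq l M) _).
  - apply/seteqP; split=> [s -> /=|s /= [sM <-]].
      split; last by rewrite size_nseq.
      elim: l => // l IHl; rewrite /= inparts_cons M0 leqnn; exact: IHl.
    elim: s sM => //= p s IHs; rewrite inparts_cons => /and3P[_ pM].
    by have -> : p = M by [lia]; move/IHs <-.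
  - by [].
  by rewrite big_nat1 bdown_nn bup_nn !mul1r sumn_nseq.
rewrite addnS; set N := (M + j)%N in IHj *.
have MN : (0 < M <= N.+1)%N by lia.
elim: l => [|l IHl].
  apply: has_sum_ext (has_sum_set1 [::] _) => //.
    by apply/seteqP; split=> [s -> //|s /= [_ /size0nil]].
  rewrite [LHS]expr0 -(sum_coef_single (@fvarX_unit R) MN).
  by apply: eq_bigr => i _; rewrite muln0 expr0 mulr1.
have IHc : has_sum (cons N.+1 @` [set s | inparts M N.+1 s /\ size s = l])
   (fun s => q ^+ sumn s) (q ^+ N.+1 * \sum_(M <= i < N.+2)
      bdown q (sgap q) i M * bup (sgap q) i N.+1 * q ^+ (i * l)).
  apply: has_sum_image (has_sumZ (q ^+ N.+1) IHl) => // [s t _ _ []|s _] //.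
  by rewrite /= exprD.
apply: has_sum_ext (has_sumU _ (IHj l.+1) IHc) => //.
- apply/seteqP; split=> s /=.
    case=> [[sMN sl]|[t [tMN <-] <-]] /=; first by rewrite inpartsS sMN.
    by rewrite inparts_cons leqnn tMN !andbT; case/andP: MN => _ ->.
  case=> + sl; rewrite inpartsS => /orP[sMN|]; first by left.
  case: s sl => // p s [sl] /and3P[_ /eqP-> sMN]; right; by exists s.
- rewrite [in RHS]big_nat_recr; last by lia.
  rewrite [X in _ + _ * X]big_nat_recr; last by lia.
  rewrite mulrDr addrA; congr (_ + _); last first.
    by rewrite mulnS exprD; ring.
  rewrite mulr_sumr -big_split !big_nat; apply: eq_bigr => i /andP[Mi iN] /=.
  rewrite -(bupS su) // /sgap mulnS exprD.
  have -> : q ^+ N.+1 = q ^+ (N.+1 - i) * q ^+ i by rewrite -exprD subnK // ltnW.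
  move: (q ^+ (N.+1 - i)) => z; ring.
move=> s [[sMN _] [t _ st]]; move: sMN; rewrite -st inparts_cons; lia.
Qed.

Lemma qdvd_fconst_fvarX (x : R) N i : (0 < i)%N -> qdvd N ((fconst x * q ^+ i) ^+ N).
Proof.
move=> i0; rewrite exprMn -exprM; apply: qdvdMl; apply: qdvdW (@qdvdX _ _).
by rewrite leq_pmull.
Qed.

Lemma has_sum_inparts (x : R) M N : (0 < M <= N)%N ->
  has_sum [set s | inparts M N s] (fun s => fconst x ^+ size s * q ^+ sumn s)
    (\prod_(M <= l < N.+1) (1 - fconst x * q ^+ l)^-1).
Proof.
move=> MN; have xu n (n0 : (0 < n)%N) := @fvarM_unit R (fconst x) n n0.
rewrite (partial_fractions_single (@fvarX_unit R)) //.
apply: (@has_sum_limit _ _ _ size _ (fun l => fconst x ^+ l *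
  \sum_(M <= i < N.+1) bdown q (sgap q) i M * bup (sgap q) i N * q ^+ (i * l))).
- move=> l; apply: has_sum_ext (has_sumZ (fconst x ^+ l) (has_sum_inparts_size l MN)).
  + by [].
  + by move=> s [_ <-].
  by [].
- by move=> s /inparts_size_sum ss; apply: qdvdMl; apply: qdvdW ss (@qdvdX _ _).
move=> L; have -> : \sum_(0 <= l < L) fconst x ^+ l * \sum_(M <= i < N.+1)
      bdown q (sgap q) i M * bup (sgap q) i N * q ^+ (i * l) =
    \sum_(M <= i < N.+1) \sum_(0 <= l < L) fconst x ^+ l *
      (bdown q (sgap q) i M * bup (sgap q) i N * q ^+ (i * l)).
  by rewrite exchange_big; apply: eq_bigr => l _; rewrite mulr_sumr.
rewrite -sumrB big_nat; apply: qdvd_sum => i /andP[Mi _].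
have i0 : (0 < i)%N by lia.
set c := bdown q (sgap q) i M * bup (sgap q) i N.
have -> : c / (1 - fconst x * q ^+ i) -
    \sum_(0 <= l < L) fconst x ^+ l * (c * q ^+ (i * l)) =
    c / (1 - fconst x * q ^+ i) * (fconst x * q ^+ i) ^+ L.
  transitivity (c * ((1 - fconst x * q ^+ i)^-1 -
      \sum_(0 <= l < L) (fconst x * q ^+ i) ^+ l)).
    rewrite mulrBr; congr (_ - _); rewrite mulr_sumr; apply: eq_bigr => l _.
    by rewrite exprMn -exprM; ring.
  by rewrite geometric_sub ?xu //; ring.
by apply: qdvdMl; apply: qdvd_fconst_fvarX.
Qed.

Definition pair_weight (u : int -> R) (p : seq nat * seq nat) : {fps R} :=
  fconst (u ((size p.1)%:Z - (size p.2)%:Z)) * q ^+ (sumn p.1 + sumn p.2).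

(* The partial fraction expansion of the generating function of the pairs of
   partitions with parts in [[M, N]], the rank [d] being weighted by [u d]. *)
Definition rank_kernel (u : int -> R) (c : nat -> {fps R}) : Prop :=
  forall M N, (0 < M <= N)%N ->
  has_sum ([set s | inparts M N s] `*` [set t | inparts M N t]) (pair_weight u)
    (\sum_(M <= i < N.+1) bdown q (bgap q) i M * bup (bgap q) i N * c i).

Lemma rank_kernel_power (x : R) : x \is a GRing.unit ->
  rank_kernel (fun d => x ^ d)
    (fun n => ((1 - fconst x * q ^+ n) * (1 - fconst x^-1 * q ^+ n))^-1).
Proof.
move=> xu M N MN; rewrite -(partial_fractions_pair (@fvarX_unit R)) //; last 2 first.
- by rewrite -fconstM divrr.
- by move=> n n0; rewrite unitrM !fvarM_unit.
apply: has_sum_ext (has_sumM (has_sum_inparts x MN) (has_sum_inparts x^-1 MN)) => //.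
  move=> [s t] _ /=; rewrite /pair_weight exprD exprzDr // -exprz_inv fconstM /=.
  rewrite -!exprnP !fconstX; ring.
rewrite -big_split !big_nat; apply: eq_bigr => l /andP[Ml _] /=.
by rewrite invrM ?fvarM_unit 1?mulrC //; lia.
Qed.

Lemma rank_kernel_zero :
  rank_kernel (fun d => (d == 0)%:R) (fun n => (1 - q ^+ n.*2)^-1).
Proof.
move=> M N MN; rewrite -(sum_coef_single2 (@fvarX_unit R)) //.
pose h l := \sum_(M <= i < N.+1) bdown q (sgap q) i M * bup (sgap q) i N * q ^+ (i * l).
pose E := [set p | [/\ inparts M N p.1, inparts M N p.2 & size p.1 = size p.2]].
apply: (@has_sum_widen _ _ E).
- by move=> p [].
- move=> p [p1 p2] pE; rewrite /pair_weight.
  case: eqP => [e|_]; last by rewrite fconst0 mul0r.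
  by case: pE; split=> //; move/eqP: e; rewrite subr_eq0 => /eqP[].
apply: (@has_sum_limit _ _ _ (fun p => size p.1) _ (fun l => h l * h l)).
- move=> l; have hl := has_sum_inparts_size l MN.
  apply: has_sum_ext (has_sumM hl hl) => //.
    apply/seteqP; split=> -[s t] /=.
      by case=> -[s1 sl] [t1 tl]; split; first split; rewrite ?sl ?tl.
    by case=> -[/= ? ? e] e'; split; split=> //; rewrite -e.
  move=> [s t] [[/= _ sl] [_ tl]]; rewrite /pair_weight /= sl tl subrr eqxx fconst1.
  by rewrite mul1r exprD.
- move=> p [/inparts_size_sum sz _ _]; apply: qdvdMl; apply: qdvdW (@qdvdX _ _).
  by rewrite (leq_trans sz) ?leq_addr.
move=> L.
have -> : \sum_(0 <= l < L) h l * h l =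
  \sum_(M <= i < N.+1) \sum_(M <= j < N.+1)
    \sum_(0 <= l < L) (bdown q (sgap q) i M * bup (sgap q) i N *
      (bdown q (sgap q) j M * bup (sgap q) j N)) * (q ^+ (i + j)) ^+ l.
  under [in RHS]eq_bigr do rewrite exchange_big /=.
  rewrite [in RHS]exchange_big /=; apply: eq_bigr => l _.
  rewrite mulr_suml; apply: eq_bigr => i _; rewrite mulr_sumr; apply: eq_bigr => j _.
  by rewrite -exprM mulnDl exprD; ring.
rewrite -sumrB big_nat; apply: qdvd_sum => i /andP[Mi _].
rewrite -sumrB; apply: qdvd_sum => j _.
have ij : (0 < i + j)%N by lia.
rewrite -mulr_sumr -mulrBr geometric_sub ?fvarX_unit // mulrCA.
rewrite -[q ^+ _]mul1r -fconst1 mulrC; apply/qdvdMl; exact: qdvd_fconst_fvarX.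
Qed.

End PartitionSums.

(** * Marked Durfee symbols *)

(* The list [l] runs from [(alpha^1, beta^1)] to [(alpha^K, beta^K)], and [M]
   bounds the parts of its first pair from below. *)
Fixpoint durfee_chain (D M : nat) (l : seq (seq nat * seq nat)) : bool :=
  if l is p :: l' then
    if l' is [::] then inparts M D p.1 && inparts M D p.2 else
    let m := largest p.1 in
    [&& p.1 != [::], (m <= D)%N, inparts M m p.1, inparts M m p.2 & durfee_chain D m l']
  else false.

Section ChainSums.
Variable R : comUnitRingType.
Notation q := (@fvar R).
Local Open Scope classical_set_scope.

Fixpoint chain_weight (u : nat -> int -> R) (l : seq (seq nat * seq nat)) : {fps R} :=
  if l is p :: l' then
    fconst (u 0%N ((size p.1)%:Z - (size p.2)%:Z - (if l' is [::] then 0 else 1))) *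
    q ^+ (sumn p.1 + sumn p.2) * chain_weight (fun j => u j.+1) l'
  else 1.

(* Deleting the largest part [m] of the first [alpha] leaves a pair of
   partitions with parts in [[M, m]], and orthogonality collapses the sum over
   [m] of the product of two partial fraction expansions to a single one. *)
Lemma has_sum_chain (u : nat -> int -> R) (c : nat -> nat -> {fps R}) r D M :
  (forall j, rank_kernel (u j) (c j)) -> (0 < M <= D)%N ->
  has_sum [set l | durfee_chain D M l /\ size l = r.+1] (chain_weight u)
    (\sum_(M <= n < D.+1) bdown q (bgap q) n M * bup (bgap q) n D *
       (q ^+ (n * r) * \prod_(j < r.+1) c j n)).
Proof.
elim: r u c M => [|r IHr] u c M uc MD.
  have -> : \sum_(M <= n < D.+1) bdown q (bgap q) n M * bup (bgap q) n D *
       (q ^+ (n * 0) * \prod_(j < 1) c j n) =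
      \sum_(M <= n < D.+1) bdown q (bgap q) n M * bup (bgap q) n D * c 0%N n.
    by apply: eq_bigr => n _; rewrite muln0 expr0 mul1r big_ord1.
  apply: (has_sum_image (h := fun p => [:: p])) (uc 0%N M D MD).
  - by move=> s t _ _ [].
  - apply/seteqP; split=> [_ [p [p1 p2] <-] /=|[|p [|p' l]] [//]] /=.
      by split=> //; rewrite p1.
    by case/andP=> p1 p2 _; exists p.
  by move=> p _; rewrite /pair_weight /= subr0 mulr1.
pose u' j := u j.+1; pose c' j := c j.+1.
pose H m := \sum_(m <= n < D.+1) bdown q (bgap q) n m * bup (bgap q) n D *
       (q ^+ (n * r) * \prod_(j < r.+1) c' j n).
pose P m := \sum_(M <= n < m.+1) bdown q (bgap q) n M * bup (bgap q) n m * c 0%N n.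
pose F m := if (M <= m)%N then q ^+ m * P m * H m else 0.
pose lab (l : seq (seq nat * seq nat)) := largest (head ([::], [::]) l).1.
pose A := [set l | durfee_chain D M l /\ size l = r.+2].
have chainE p l : size l = r.+1 -> durfee_chain D M (p :: l) =
    [&& p.1 != [::], (largest p.1 <= D)%N, inparts M (largest p.1) p.1,
        inparts M (largest p.1) p.2 & durfee_chain D (largest p.1) l] by case: l.
have AF m : (m < D.+1)%N -> has_sum [set l | A l /\ lab l = m] (chain_weight u) (F m).
  move=> mD; rewrite /F; case: leqP => [Mm | mM]; last first.
    apply: has_sum_ext (has_sum_set0 _) => //.
    apply/seteqP; split=> // -[|p l] [[] //]; rewrite /lab /= => + [sl].
    rewrite -/(durfee_chain D M (p :: l)) chainE //.
    case: p => -[|h s] t //= /and4P[_ + _ _]; rewrite inparts_cons; lia.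
  have M0m : (0 < M <= m)%N by lia.
  have m0D : (0 < m <= D)%N by lia.
  have := has_sumZ (q ^+ m)
    (has_sumM (uc 0%N M m M0m) (IHr u' c' m (fun j => uc j.+1) m0D)).
  rewrite mulrA => sumAm.
  pose h (x : (seq nat * seq nat) * seq (seq nat * seq nat)) :=
    (m :: x.1.1, x.1.2) :: x.2.
  apply: (has_sum_image (h := h)) sumAm.
  - by move=> [[s t] l] [[s' t'] l'] _ _ [-> -> ->].
  - apply/seteqP; split=> [_ [[[s t] l] [[/= sM tM] [lD sl]] <-]|] /=.
      split=> //; split; last by rewrite /= sl.
      rewrite -/(durfee_chain D M ((m :: s, t) :: l)) chainE //= inparts_cons.
      by rewrite sM tM lD /= leqnn; lia.
    move=> [|p l] [[] //]; rewrite -/(durfee_chain D M (p :: l)) => + [sl].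
    rewrite chainE // /lab /=; case: p => -[|x s] t //=.
    case/and4P=> _ + tM lD xm; rewrite xm in tM lD *.
    rewrite inparts_cons => /and3P[_ _ sM].
    by exists ((s, t), l).
  move=> [[s t] l] [[/= sM tM] [lD sl]].
  have -> : (if l is [::] then 0 else 1 : int) = 1 by case: l sl {lD}.
  rewrite /pair_weight /= (_ : (size s).+1%:Z - _ - 1 = (size s)%:Z - (size t)%:Z).
    by rewrite -addnA (exprD _ m) (mulrCA _ (q ^+ m)) !mulrA.
  by rewrite intS; ring.
apply: has_sum_ext (has_sum_label AF) => //.
  apply/seteqP; split=> l /=; first by case.
  move=> Al; split=> //; case: Al => + sl; rewrite /lab; case: l sl => // p l [sl].
  by rewrite chainE // => /and5P[].
transitivity (\sum_(M <= m < D.+1) q ^+ m * P m * H m).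
  rewrite [RHS](big_nat_widenl _ 0%N) // [RHS]big_mkcond /=.
  by apply: eq_bigr => m _; rewrite /F.
rewrite (bup_bdown_comp (bgap_unit (@fvarX_unit R)) (bgapB q)).
apply: eq_bigr => n _; rewrite mulnS exprD [in RHS]big_ord_recl; congr (_ * _).
rewrite -[\prod_(j < r.+1) c' j n]/(\prod_(j < r.+1) c (lift ord0 j) n).
by rewrite -!mulrA; congr (_ * _); rewrite mulrCA.
Qed.

Lemma chain_weightE u l : chain_weight u l =
  fconst (\prod_(j < size l) u j ((size (nth ([::], [::]) l j).1)%:Z -
      (size (nth ([::], [::]) l j).2)%:Z - (if (j.+1 < size l)%N then 1 else 0))) *
  q ^+ (\sum_(j < size l)
          (sumn (nth ([::], [::]) l j).1 + sumn (nth ([::], [::]) l j).2)).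
Proof.
elim: l u => [|p l IHl] u; first by rewrite !big_ord0 fconst1 expr0 mulr1.
have e : (if l is [::] then 0 else 1 : int) = if (1 < (size l).+1)%N then 1 else 0.
  by case: (l).
by rewrite /= {}e IHl mulrACA !big_ord_recl fconstM -exprD.
Qed.

End ChainSums.

Lemma inparts_bounds M N s : inparts M N s ->
  [/\ is_partition s, s != [::] -> (M <= Defs.smallest s)%N & (largest s <= N)%N].
Proof.
case/andP=> sp; case: s sp => [|p s] // sp sMN; split=> //.
  by move=> _; have /andP[] := allP sMN _ (mem_last p s).
by have /andP[] := allP sMN p (mem_head p s).
Qed.

Lemma partition_inparts M N s : is_partition s ->
  (s != [::] -> (M <= Defs.smallest s)%N) -> (largest s <= N)%N -> inparts M N s.
Proof.
elim: s N => [|p s IHs] N //= sp Ms pN; rewrite inparts_cons.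
have [p0 ss ps] : [/\ (0 < p)%N, is_partition s & (largest s <= p)%N].
  case/andP: sp => /= sp; rewrite inE negb_or eq_sym -lt0n => /andP[-> s0]; split=> //.
    by rewrite /is_partition (path_sorted sp).
  by case: s sp {s0 IHs Ms} => //= r s /andP[].
have sM : inparts M p s.
  by apply: IHs => // sN; have := Ms isT; case: s sN {Ms sp ss ps}.
rewrite p0 pN sM !andbT /=.
case: s sM Ms {IHs sp ss ps} => [_ /(_ isT) //|r s].
by rewrite inparts_cons => /and3P[_ /andP[Mr rp] _] _; apply: leq_trans rp.
Qed.

Lemma chainP D M l : (0 < size l)%N ->
  durfee_chain D M l <-> forall j, (j < size l)%N ->
    let a := (nth ([::], [::]) l j).1 in let b := (nth ([::], [::]) l j).2 in
    let lo := if j is i.+1 then largest (nth ([::], [::]) l i).1 else M in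
    let hi := if (j.+1 < size l)%N then largest a else D in
    [/\ inparts lo hi a, inparts lo hi b &
       (j.+1 < size l)%N -> a != [::] /\ (largest a <= D)%N].
Proof.
elim: l M => // p [|p' l] IHl M _.
  split=> [/= /andP[p1 p2] [|j] //|/(_ 0%N isT)[p1 p2 _]]; apply/andP; split=> //.
have -> : durfee_chain D M [:: p, p' & l] =
  [&& p.1 != [::], (largest p.1 <= D)%N, inparts M (largest p.1) p.1,
      inparts M (largest p.1) p.2 & durfee_chain D (largest p.1) (p' :: l)] by [].
split=> [/and5P[p0 pD p1 p2 /IHl] /(_ isT) IH [|j] jl|cl].
- by [].
- have := IH j jl; case: j jl => [|j] jl //.
have [p1 p2 /(_ isT)[p0 pD]] := cl 0%N isT.
apply/and5P; split=> //; apply/IHl => // j jl.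
by have := cl j.+1 jl; case: j jl.
Qed.

Section Symbols.
Variable K : nat.
Local Open Scope classical_set_scope.

Definition symbol_of (D : nat) (l : seq (seq nat * seq nat)) : symbol K :=
  ([ffun j : 'I_K => (nth ([::], [::]) l j).1],
   [ffun j : 'I_K => (nth ([::], [::]) l j).2], D).

Lemma leq_min_smallest m (t : symbol K) j :
  (m <= min_smallest t j)%N =
  [&& (m <= side t)%N, (alpha t j != [::]) ==> (m <= Defs.smallest (alpha t j))%N &
      (beta t j != [::]) ==> (m <= Defs.smallest (beta t j))%N].
Proof.
rewrite /min_smallest !big_cons big_nil; case: (alpha t j != [::]);
  case: (beta t j != [::]); rewrite ?leq_min /= ?andbT //.
- by rewrite andbA andbC.
- by rewrite andbC.
by rewrite andbC.
Qed.

Lemma marked_durfee_chain D : (0 < K)%N -> (0 < D)%N ->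
  symbol_of D @` [set l | durfee_chain D 1 l /\ size l = K] =
  [set t | is_marked_durfee t /\ side t = D].
Proof.
move=> K0 D0; apply/seteqP; split.
  move=> _ [l [lc sl] <-]; split=> //.
  have {}lc := (chainP _ _ _).1 lc; rewrite sl in lc.
  have lcj (j : 'I_K) := lc K0 j (ltn_ord j).
  split=> //.
  - move=> j; rewrite /alpha /beta !ffunE.
    by have [/inparts_bounds[? _ _] /inparts_bounds[? _ _] _] := lcj j.
  - move=> j jK; rewrite /alpha !ffunE; by have [_ _ /(_ jK)[]] := lcj j.
  - move=> i j ji; have iK : (i.+1 < K)%N by rewrite -ji.
    rewrite leq_min_smallest /alpha /beta /side !ffunE /= ji.
    have [_ /inparts_bounds[_ _] + /(_ iK)[_ ->]] := lcj i.
    rewrite iK => bi; split=> //.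
    have := lcj j; rewrite ji => -[/inparts_bounds[_ + _] /inparts_bounds[_ + _] _].
    by move=> aj bj /=; apply/andP; split; apply/implyP.
  move=> j jK; rewrite /alpha /beta /side !ffunE /=.
  by have [/inparts_bounds[_ _ +] /inparts_bounds[_ _ +] _] := lcj j; rewrite jK ltnn.
move=> t [[_ pt nt mt Dt] tD].
pose l := [seq (alpha t j, beta t j) | j <- enum 'I_K].
have sl : size l = K by rewrite size_map size_enum_ord.
have nl (j : 'I_K) : nth ([::], [::]) l j = (alpha t j, beta t j).
  by rewrite (nth_map j) ?size_enum_ord ?nth_ord_enum.
exists l; last first.
  rewrite /symbol_of -tD; case: t l {sl pt nt mt Dt tD} nl => -[a b] E l nl.
  by congr (_, _, _); apply/ffunP => j; rewrite ffunE nl.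
split=> //; apply/chainP; rewrite ?sl // => j jK.
pose j' := Ordinal jK; rewrite (nl j') /=.
have [pa pb] := pt j'.
set lo := (X in inparts X _ _); set hi := (X in inparts _ X _).
have [ahi bhi] : (largest (alpha t j') <= hi)%N /\ (largest (beta t j') <= hi)%N.
  rewrite /hi; case: ltnP => [jK' | Kj]; last first.
    by rewrite -tD; apply: Dt; apply/eqP; rewrite eqn_leq Kj andbT; apply: jK.
  by split=> //; have [] := mt j' (Ordinal jK') erefl.
have [alo blo] : (alpha t j' != [::] -> (lo <= Defs.smallest (alpha t j'))%N) /\
    (beta t j' != [::] -> (lo <= Defs.smallest (beta t j'))%N).
  have spos s : is_partition s -> s != [::] -> (0 < Defs.smallest s)%N.
    case/andP=> _; case: s => // r s; rewrite lt0n => + _; apply: contra => /eqP <-.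
    exact: mem_last.
  rewrite /lo; case: j jK @j' pa pb {ahi bhi hi lo} => [|i] /= jK pa pb.
    by split; apply: spos.
  have iK := ltnW jK; have [_] := mt (Ordinal iK) (Ordinal jK) erefl.
  rewrite leq_min_smallest (nl (Ordinal iK)) => /and3P[_ /implyP ? /implyP ?] //.
split; [exact: partition_inparts | exact: partition_inparts |].
move=> jK'; split; first exact: nt.
by have [_] := mt j' (Ordinal jK') erefl; rewrite leq_min_smallest tD => /and3P[].
Qed.

Lemma symbol_of_inj D l l' : size l = K -> size l' = K ->
  symbol_of D l = symbol_of D l' -> l = l'.
Proof.
move=> sl sl' [/ffunP ea /ffunP eb].
apply: (@eq_from_nth _ ([::], [::])); rewrite sl ?sl' // => j jK.
have := ea (Ordinal jK); have := eb (Ordinal jK); rewrite !ffunE /=.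
by case: (nth _ l j) => ? ?; case: (nth _ l' j) => ? ? /= -> ->.
Qed.

End Symbols.

Section SymbolSums.
Variables (R : comUnitRingType) (u : nat -> int -> R) (c : nat -> nat -> {fps R}).
Hypothesis uc : forall j, rank_kernel (u j) (c j).
Notation q := (@fvar R).
Local Open Scope classical_set_scope.

Definition symbol_weight K (t : symbol K) : {fps R} :=
  fconst (\prod_(j < K) u j (durfee_rank t j)) * q ^+ durfee_weight t.

Lemma symbol_weight_of D (l : seq (seq nat * seq nat)) :
  symbol_weight (symbol_of (size l) D l) = q ^+ (D ^ 2) * chain_weight u l.
Proof.
rewrite chain_weightE mulrCA -exprD addnC; congr (fconst _ * _ ^+ (_ + _)).
  by apply: eq_bigr => j _; rewrite /durfee_rank /alpha /beta !ffunE.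
by apply: eq_bigr => j _; rewrite /alpha /beta !ffunE.
Qed.

Definition symbol_series r D : {fps R} :=
  q ^+ (D ^ 2) * \sum_(1 <= n < D.+1) bdown q (bgap q) n 1 * bup (bgap q) n D *
    (q ^+ (n * r) * \prod_(j < r.+1) c j n).

Lemma has_sum_symbols r N :
  has_sum [set t : symbol r.+1 | is_marked_durfee t /\ (side t < N.+1)%N]
    (@symbol_weight r.+1) (\sum_(1 <= D < N.+1) symbol_series r D).
Proof.
pose F D := if (0 < D)%N then symbol_series r D else 0.
apply: has_sum_ext (@has_sum_label _ _ _ (@side r.+1) _ F N.+1 _) => //; last first.
  move=> D _; rewrite /F; case: D => [|D] /=.
    apply: has_sum_ext (@has_sum_set0 _ _ _) => //.
    by apply/seteqP; split=> // t [[t0 _ _ _ _] e]; rewrite e in t0.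
  have D1 : (0 < 1 <= D.+1)%N by [].
  apply: (has_sum_image (h := symbol_of r.+1 D.+1))
    (has_sumZ (q ^+ (D.+1 ^ 2)) (has_sum_chain r uc D1)).
  - by move=> l l' [_ sl] [_ sl']; apply: symbol_of_inj.
  - exact: marked_durfee_chain.
  by move=> l [_ sl]; rewrite -symbol_weight_of sl.
rewrite big_ltn // add0r !big_nat; apply: eq_bigr => D /andP[D0 _].
by rewrite /F D0.
Qed.

Lemma fcoef_symbol_weight K (t : symbol K) n :
  fcoef (symbol_weight t) n =
  if durfee_weight t == n then \prod_(j < K) u j (durfee_rank t j) else 0.
Proof.
rewrite /symbol_weight mulrC; set w := durfee_weight t.
elim: w n => [|w IHw] [|n]; rewrite ?expr0 ?mul1r //.
- by rewrite exprS -mulrA fcoef_varM.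
by rewrite exprS -mulrA fcoef_varM IHw.
Qed.

Lemma fcoef_symbol_series r n N : (n <= N)%N ->
  fcoef (\sum_(1 <= D < N.+1) symbol_series r D) n =
  \sum_(t \in [set t : symbol r.+1 | is_marked_durfee t /\ durfee_weight t = n])
     \prod_(j < r.+1) u j (durfee_rank t j).
Proof.
move=> nN; rewrite (has_sum_coef n (has_sum_symbols r N)).
rewrite [LHS]fsbig_mkcond [RHS]fsbig_mkcond; apply: eq_fsbigr => t _.
rewrite /patch fcoef_symbol_weight.
case: (pselect (is_marked_durfee t)) => mt; last first.
  by rewrite !memNset //; case.
case: eqP => wt; last first.
  rewrite [in RHS]memNset; last by case.
  by case: ifP.
rewrite !mem_set //; split=> //.
rewrite ltnS (leq_trans _ nN) // -wt /durfee_weight (leq_trans _ (leq_addl _ _)) //.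
by rewrite -mulnn; case: (side t) => // d; rewrite leq_pmull.
Qed.

End SymbolSums.

Section CountSum.
Variables (k n : nat).
Local Open Scope classical_set_scope.

Definition other_ranks (t : symbol k.+1) : {ffun 'I_k -> int} :=
  [ffun j => durfee_rank t (lift ord0 j)].

Definition rank0_symbols : set (symbol k.+1) :=
  [set t | [/\ is_marked_durfee t, durfee_weight t = n & durfee_rank t ord0 = 0]].

Lemma durfee_set_cons0 m :
  durfee_set (cons0 m) n = rank0_symbols `&` [set t | other_ranks t = m].
Proof.
apply/seteqP; split=> t /=.
  case=> mt wt rt; split; first by split=> //; rewrite rt ffunE unlift_none.
  by apply/ffunP => j; rewrite ffunE rt ffunE liftK.
case=> -[mt wt r0] rm; split=> // j; rewrite ffunE.
by case: unliftP => [i|] -> //=; rewrite -rm ffunE.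
Qed.

Lemma finite_rank0_symbols : finite_set rank0_symbols.
Proof.
pose A := [set m : {ffun 'I_k -> int} | durfee_count (cons0 m) n != 0%N].
apply: (@sub_finite_set _ _ (\bigcup_(m in A) durfee_set (cons0 m) n)).
  move=> t tS; have tm : durfee_set (cons0 (other_ranks t)) n t.
    by rewrite durfee_set_cons0.
  exists (other_ranks t) => //; rewrite /A /= /durfee_count cardfs_eq0.
  apply/eqP => /fsetP/(_ t); rewrite in_fset_set; last exact: finite_marked_durfee.
  by rewrite mem_set // inE.
apply: bigcup_finite; first exact: finite_support_durfee.
by move=> m _; apply: finite_marked_durfee.
Qed.

Lemma sum_durfee_count (R : comNzRingType) (f : {ffun 'I_k -> int} -> R) :
  \sum_(m \in [set: {ffun 'I_k -> int}]) (durfee_count (cons0 m) n)%:R * f m =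
  \sum_(t \in rank0_symbols) f (other_ranks t).
Proof.
have Sfin := finite_rank0_symbols.
rewrite [RHS]fsbig_finite //=; set S := fset_set _.
have cE m : (durfee_count (cons0 m) n)%:R = \sum_(t <- S) (other_ranks t == m)%:R :> R.
  rewrite /durfee_count card_fset_sum1 natr_sum.
  rewrite -(@fsbig_finite _ _ _ _ _ (fun=> 1)); last exact: finite_marked_durfee.
  rewrite durfee_set_cons0 fsbig_mkcondr fsbig_finite //; apply: eq_bigr => t _.
  by case: eqP => e; [rewrite mem_set | rewrite memNset].
rewrite (@fsbigE _ _ _ _ _ (undup [seq other_ranks t | t <- S])); first last.
- move=> m _ mS; rewrite cE big1_seq ?mul0r // => t /andP[_ tS].
  case: eqP => // e; case/negP: mS; rewrite mem_undup -e; exact: map_f.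
- by [].
- exact: undup_uniq.
rewrite (eq_bigl xpredT) => [|m]; last by rewrite mem_set.
under eq_bigr do rewrite cE mulr_suml.
rewrite exchange_big; apply: eq_big_seq => t tS /=.
rewrite (bigD1_seq (other_ranks t)) ?undup_uniq ?mem_undup ?map_f //= eqxx mul1r.
by rewrite big1 ?addr0 // => m; rewrite eq_sym => /negPf->; rewrite mul0r.
Qed.

End CountSum.

Theorem theorem3p1 (k : nat) (hk : (0 < k)%N) :
  Fps (fun n : nat =>
    \sum_(m \in [set: {ffun 'I_k -> int}]%classic)
      (durfee_count (cons0 m) n)%:R * \prod_(j < k) lvar j ^ m j) =
  (qpoch_infty (laurent k))^-1 *
  flim (fun N =>
    \sum_(1 <= n < N.+1)
      (-1) ^+ n.-1 * fvar ^+ (n * (3 * n - 1) %/ 2 + k * n)%N * (1 - fvar ^+ n) /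
      \prod_(j < k) ((1 - fconst (lvar j) * fvar ^+ n) *
                     (1 - fconst (lvar j)^-1 * fvar ^+ n))).
Proof.
set q := @fvar (laurent k); set L := Fps _.
pose E (j : 'I_k) n :=
  (1 - fconst (lvar j) * q ^+ n) * (1 - fconst (lvar j)^-1 * q ^+ n).
pose T n := (-1) ^+ n.-1 * q ^+ (n * (3 * n - 1) %/ 2 + k * n)%N * (1 - q ^+ n) /
  \prod_(j < k) E j n.
pose y (i : nat) : laurent k := oapp (@lvar k) 1 (insub i).
have yu i : y i \is a GRing.unit.
  by rewrite /y; case: insubP => [j _ _|_] /=; rewrite ?lvar_unit ?unitr1.
pose u j d : laurent k := if j is i.+1 then y i ^ d else (d == 0)%:R.
pose c j n := if j is i.+1 then
  ((1 - fconst (y i) * q ^+ n) * (1 - fconst (y i)^-1 * q ^+ n))^-1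
  else (1 - q ^+ n.*2)^-1.
have uc j : rank_kernel (u j) (c j).
  by case: j => [|i]; [exact: rank_kernel_zero | exact: rank_kernel_power].
have LE n N : (n <= N)%N ->
    fcoef L n = fcoef (\sum_(1 <= D < N.+1) symbol_series c k D) n.
  move=> nN; rewrite (fcoef_symbol_series uc k nN) /= sum_durfee_count.
  rewrite [LHS]fsbig_mkcond [RHS]fsbig_mkcond; apply: eq_fsbigr => t _.
  rewrite /patch.
  have [[mt wt] | nt] := pselect (is_marked_durfee t /\ durfee_weight t = n); last first.
    by rewrite [in RHS]memNset // memNset // => -[mt wt _]; apply: nt.
  rewrite [in RHS]mem_set // big_ord_recl /=; case: eqP => r0; last first.
    by rewrite mul0r memNset // => -[].
  rewrite mem_set // mul1r; apply: eq_bigr => j _.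
  by rewrite ffunE /y valK.
have TE n : (0 < n)%N -> (-1) ^+ n.-1 * q ^+ (n * (3 * n - 1) %/ 2) * (1 - q ^+ n) *
    (1 - q ^+ n.*2) * (q ^+ (n * k) * \prod_(j < k.+1) c j n) = T n.
  move=> n0; rewrite big_ord_recl /T exprD (mulnC k).
  have -> : \prod_(j < k) c (lift ord0 j) n = (\prod_(j < k) E j n)^-1.
    transitivity (\prod_(j < k) (E j n)^-1).
      by apply: eq_bigr => j _; rewrite /c /= /y valK.
    apply: prodrV => j _; rewrite /E unitrM; apply/andP; split; exact: fvarM_unit.
  have := divrr (@fvarX_unit (laurent k) n.*2 _); rewrite double_gt0 => /(_ n0).
  rewrite /c /=; move: (1 - q ^+ n.*2) => a; move: (a^-1) => b ab.
  move: ((\prod_(_ < _) _)^-1) (1 - q ^+ n) ((-1) ^+ n.-1) (q ^+ (n * k)) => p v w x.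
  by move: (q ^+ _) => z; rewrite -[v in RHS]mulr1 -ab; ring.
have T0 N n : (n < N)%N -> fcoef (T N) n = 0.
  move=> nN; suff /(_ n nN) : qdvd N (T N) by [].
  rewrite /T -mulrA mulrAC; apply/qdvdMl/qdvdW/qdvdX.
  by rewrite (leq_trans _ (leq_addl _ _)) // leq_pmull.
apply: (mulrI (qpoch_infty_unit (laurent k))).
rewrite mulrA divrr ?qpoch_infty_unit // mul1r.
apply/fpsP => n; have [M TM] := fcvg_series T0 n.
pose N := maxn n M; rewrite -(TM N (leq_maxr _ _)).
have LN : qdvd N.+1 (L - \sum_(1 <= D < N.+1) symbol_series c k D).
  by move=> i iN; rewrite fcoefD fcoefN (@LE i N) ?subrr.
have := qdvdD
  (@durfee_to_pentagonal _ (fun n => q ^+ (n * k) * \prod_(j < k.+1) c j n) N)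
  (qdvdMl (qpoch_infty (laurent k)) LN).
move=> /(_ n); rewrite ltnS leq_maxl => /(_ isT).
rewrite -/(\sum_(1 <= D < N.+1) symbol_series c k D).
rewrite mulrBr addrC addrA subrK fcoefD fcoefN => /eqP; rewrite subr_eq0 => /eqP ->.
congr (fcoef _ n); rewrite !big_nat; apply: eq_bigr => i /andP[i0 _]; exact: TE.
Qed.
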